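(* Let $x\in[\lambda,\lambda^{-1}]$, let $X=\{z\in(0,\infty):\mathcal{M}(z)=x\}$ and $Y=X\cap(1/3,3]$ (so $X=\bigcup_{k\in\mathbb{Z}}s_k(Y)$). (1) The set of time-invariant Nash equilibria of $\mathrm{Standard}(x)=\mathrm{Trail}(0,1,x,0)$ is exactly the set of maps $\mathbb{Z}\to(0,\infty)^2$, $i\mapsto(b^{\rm st}_i(z),a^{\rm st}_i(z))$, $z\in X$. (2) Equivalently, it is the set of maps $i\mapsto(b^{\rm st}_{i+j}(y),a^{\rm st}_{i+j}(y))$ with $(y,j)$ ranging over $Y\times\mathbb{Z}$.
   Context: Trail of Lost Pennies $\mathrm{Trail}(m_{-\infty},m_\infty,n_{-\infty},n_\infty)$ (with fixed reals $m_*\le m_{-\infty}$, $n_*\le n_\infty$): a strategy is $S:\mathbb{Z}\times\mathbb{N}_+\to[0,\infty)$, time-invariant if independent of the second argument; a time-invariant pair is written $\{(b_i,a_i)\}$ (Mina stakes $b_i$, Maxine $a_i$ at site $i$). Gameplay from $X_0=k$ steps $+1$ with probability $\frac{S_+(X_{t-1},t)}{S_-(X_{t-1},t)+S_+(X_{t-1},t)}$ and $-1$ otherwise ($0/0=1/2$). Payoffs: Mina $P_-=-\sum_t S_-(X_{t-1},t)+T_-$, $T_-=n_{-\infty},n_\infty,n_*$ on $\{\limsup X=-\infty\}$, $\{\liminf X=\infty\}$, and otherwise; Maxine $P_+=-\sum_tS_+(X_{t-1},t)+T_+$, $T_+=m_{-\infty},m_\infty,m_*$ correspondingly. Nash equilibrium: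 no player can increase her expected payoff by switching to any strategy, for every starting point $k\in\mathbb{Z}$. ABMN system on $\mathbb{Z}$: $a_i,b_i\ge0$, $m_i,n_i\in\mathbb{R}$ with $(a_i+b_i)(m_i+a_i)=a_im_{i+1}+b_im_{i-1}$, $(a_i+b_i)(n_i+b_i)=a_in_{i+1}+b_in_{i-1}$, $(a_i+b_i)^2=b_i(m_{i+1}-m_{i-1})$, $(a_i+b_i)^2=a_i(n_{i-1}-n_{i+1})$ for all $i$; positive if all $a_i,b_i>0$. Standard: positive with $\lim_{-\infty}m=0$, $\lim_{\infty}n=0$, $\lim_\infty m=1$; for $z>0$, $(a^{\rm st}(z),b^{\rm st}(z),m^{\rm st}(z),n^{\rm st}(z))$ is the unique standard solution with central ratio $\frac{n_{-1}-n_0}{m_0-m_{-1}}=z$; $\mathcal{M}(z)=\lim_{i\to-\infty}n^{\rm st}_i(z)$. $\lambda$ is the infimum of Mina margins $\frac{n_{-\infty}-n_\infty}{m_\infty-m_{-\infty}}$ of positive solutions. $s(x)=\frac{(\omega-1)^2}{4(\omega+7)}$, $\omega=\sqrt{8x+1}$; $s_0=\mathrm{id}$, $s_{-1}(x)=1/s(1/x)$, $s_i=s\circ s_{i-1}$, $s_{-i}=s_{-1}\circ s_{-(i-1)}$. *)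

(* Defs.v *)
From HB Require Import structures.
From mathcomp Require Import all_boot all_order all_algebra.
From mathcomp Require Import all_classical all_reals all_analysis.
Import Order.TTheory GRing.Theory Num.Theory.
Import numFieldNormedType.Exports.

Set Implicit Arguments.
Unset Strict Implicit.
Unset Printing Implicit Defensive.

Local Open Scope classical_set_scope.
Local Open Scope ring_scope.

Section Uniform.
Context {R : realType} {d : measure_display} {T : measurableType d}.

Definition iid_uniform (P : probability T R) (U : nat -> T -> R) : Prop :=
  [/\ (forall t, measurable_fun setT (U t)),
      (forall t (c : R), 0 <= c <= 1 -> P (U t @^-1` `]-oo, c[) = c%:E) &
      (forall (s : seq nat) (A : nat -> set R), uniq s ->
          (forall i, measurable (A i)) ->
          P (\big[setI/setT]_(i <- s) (U i @^-1` A i))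
          = (\prod_(i <- s) P (U i @^-1` A i))%E)].
End Uniform.

(* A strategy is S : int -> nat -> R ; S i t is the stake at site i at *)
(* turn t.+1 (the turn index N_+ is shifted by one to nat).            *)
Section Game.
Context {R : realType}.

Definition strategy (S : int -> nat -> R) : Prop := forall i t, 0 <= S i t.

Definition time_invariant (S : int -> nat -> R) : Prop :=
  forall i t t', S i t = S i t'.

Definition up_prob (Sm Sp : int -> nat -> R) (i : int) (t : nat) : R :=
  if Sm i t + Sp i t == 0 then 2^-1 else Sp i t / (Sm i t + Sp i t).

Context {d : measure_display} {T : measurableType d}.

Fixpoint walk (Sm Sp : int -> nat -> R) (U : nat -> T -> R) (k : int)
  (t : nat) (w : T) : int :=
  match t with
  | 0%N => k
  | t'.+1 => let x := walk Sm Sp U k t' w in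
             if U t' w < up_prob Sm Sp x t' then x + 1 else x - 1
  end.

Definition limsup_is_ninfty (x : nat -> int) : Prop :=
  forall M : int, exists N : nat, forall t, (N <= t)%N -> x t <= M.
Definition liminf_is_pinfty (x : nat -> int) : Prop :=
  forall M : int, exists N : nat, forall t, (N <= t)%N -> M <= x t.

Definition terminal (vdown vup vstar : R) (x : nat -> int) : \bar R :=
  if `[< limsup_is_ninfty x >] then vdown%:E
  else if `[< liminf_is_pinfty x >] then vup%:E else vstar%:E.

Definition total_stake (S : int -> nat -> R) (x : nat -> int) : \bar R :=
  (\sum_(0 <= t <oo) (S (x t) t)%:E)%E.

(* Trail(mdn, mup, ndn, nup) with the fixed reals mst (m_* ) and nst (n_* ) *)
Definition payoff_mina (ndn nup nst : R) (Sm Sp : int -> nat -> R)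
  (U : nat -> T -> R) (k : int) (w : T) : \bar R :=
  (- total_stake Sm (walk Sm Sp U k ^~ w)
   + terminal ndn nup nst (walk Sm Sp U k ^~ w))%E.

Definition payoff_maxine (mdn mup mst : R) (Sm Sp : int -> nat -> R)
  (U : nat -> T -> R) (k : int) (w : T) : \bar R :=
  (- total_stake Sp (walk Sm Sp U k ^~ w)
   + terminal mdn mup mst (walk Sm Sp U k ^~ w))%E.

Definition Nash_equilibrium (P : probability T R) (U : nat -> T -> R)
  (mdn mup ndn nup mst nst : R) (Sm Sp : int -> nat -> R) : Prop :=
  forall k : int,
    (forall S', strategy S' ->
       (\int[P]_w payoff_mina ndn nup nst S' Sp U k w
        <= \int[P]_w payoff_mina ndn nup nst Sm Sp U k w)%E) /\
    (forall S', strategy S' ->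
       (\int[P]_w payoff_maxine mdn mup mst Sm S' U k w
        <= \int[P]_w payoff_maxine mdn mup mst Sm Sp U k w)%E).

Definition ti_mina (b : int -> R) : int -> nat -> R := fun i _ => b i.
Definition ti_maxine (a : int -> R) : int -> nat -> R := fun i _ => a i.

End Game.

Section ABMN.
Context {R : realType}.

Definition ABMN (a b m n : int -> R) : Prop :=
  forall i : int,
    [/\ 0 <= a i /\ 0 <= b i,
        (a i + b i) * (m i + a i) = a i * m (i + 1) + b i * m (i - 1),
        (a i + b i) * (n i + b i) = a i * n (i + 1) + b i * n (i - 1),
        (a i + b i) ^+ 2 = b i * (m (i + 1) - m (i - 1)) &
        (a i + b i) ^+ 2 = a i * (n (i - 1) - n (i + 1))].

Definition positive_ABMN (a b m n : int -> R) : Prop :=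
  ABMN a b m n /\ forall i, 0 < a i /\ 0 < b i.

Definition lim_pinfty (f : int -> R) (l : R) : Prop :=
  (fun k : nat => f k%:Z) @ \oo --> l.
Definition lim_ninfty (f : int -> R) (l : R) : Prop :=
  (fun k : nat => f (- k%:Z)) @ \oo --> l.

Definition standard_ABMN (a b m n : int -> R) : Prop :=
  [/\ positive_ABMN a b m n, lim_ninfty m 0, lim_pinfty n 0 & lim_pinfty m 1].

Definition central_ratio (m n : int -> R) : R :=
  (n (-1) - n 0) / (m 0 - m (-1)).

Definition standard_with_ratio (z : R)
  (q : (int -> R) * (int -> R) * (int -> R) * (int -> R)) : Prop :=
  let: (a, b, m, n) := q in standard_ABMN a b m n /\ central_ratio m n = z.

(* the (unique, by the paper) standard solution with central ratio z *)
Definition st_sol (z : R) : (int -> R) * (int -> R) * (int -> R) * (int -> R) :=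
  match pselect (exists q, standard_with_ratio z q) with
  | left H => projT1 (cid H)
  | right _ => (fun _ => 0, fun _ => 0, fun _ => 0, fun _ => 0)
  end.

Definition a_st (z : R) : int -> R := (st_sol z).1.1.1.
Definition b_st (z : R) : int -> R := (st_sol z).1.1.2.
Definition m_st (z : R) : int -> R := (st_sol z).1.2.
Definition n_st (z : R) : int -> R := (st_sol z).2.

Definition Mcal (z : R) : R := limn (fun k : nat => n_st z (- k%:Z)).

Definition mina_margins : set R :=
  [set r | exists a b m n mdn mup ndn nup,
     [/\ positive_ABMN a b m n,
         lim_ninfty m mdn /\ lim_pinfty m mup, lim_ninfty n ndn, lim_pinfty n nup &
         r = (ndn - nup) / (mup - mdn)]].

Definition lambda : R := inf mina_margins.

Definition s_map (x : R) : R :=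
  let w := Num.sqrt (8 * x + 1) in (w - 1) ^+ 2 / (4 * (w + 7)).
Definition s_inv (x : R) : R := (s_map x^-1)^-1.
Definition s_iter (k : int) : R -> R :=
  match k with
  | Posz n => iter n s_map
  | Negz n => iter n.+1 s_inv
  end.

End ABMN.

(* Main.v *)
Require Import Defs.
From HB Require Import structures.
From mathcomp Require Import all_boot all_order all_algebra.
From mathcomp Require Import all_classical all_reals all_analysis.
From mathcomp Require Import measurable_realfun.
From mathcomp Require Import ring lra zify.
Import Order.TTheory GRing.Theory Num.Theory.
Import numFieldNormedType.Exports.

Set Implicit Arguments.
Unset Strict Implicit.
Unset Printing Implicit Defensive.

Local Open Scope classical_set_scope.
Local Open Scope ring_scope.

(** A time-invariant equilibrium has values m_i (Maxine) and n_i (Mina) at each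
    site. Optimality against deviations at the first turn only gives the ABMN
    equations wherever a stake is positive; a site without stakes forces all
    stakes to vanish, and then Maxine would gain by betting tiny amounts on a
    walk that is otherwise symmetric. In a positive solution the total stakes
    have finite mean, so every site is visited finitely often and the walk tends
    to one of the two ends; comparing the limit of m (resp. n) along the walk
    with the terminal payments, from starting points far to the right and far to
    the left, identifies the boundary values. Conversely, for a solution with
    these boundary values, m and n minus the stakes spent are supermartingales
    under every deviation and martingales at the equilibrium.

    Positive solutions are explicit in the ratio r = b_i/a_i: the ratio of the
    increments of n and m at site i is r(1+2r), and at site i+1 it is
    r^2/(2+r) = s(r(1+2r)). The central ratio thus determines all ratios, and
    the increments decay geometrically at both ends, so it parametrises the
    standard solutions, a shift by one site acting on it as s. *)

(** * Path space and the first-step decomposition of the walk *)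

HB.instance Definition _ := isPointed.Build int 0.

Definition cylinder (t : nat) (y : nat -> int) : set (nat -> int) :=
  [set x | forall s, (s < t)%N -> x s = y s].

(* The empty set is added to make the cylinders a pi-system. *)
Definition cylinders : set (set (nat -> int)) :=
  [set C | C = set0 \/ exists t y, C = cylinder t y].

(** The product sigma-algebra of the discrete one on [int], generated by prefixes so that laws of
    walks can be compared on cylinders alone. *)
Definition paths := g_sigma_algebraType cylinders.

(** Of two cylinders, the longer lies inside the shorter or misses it, according to whether their
    reference paths agree on the shorter prefix. *)
Lemma cylinders_setI : setI_closed cylinders.
Proof.
have aux t y t' y' : (t <= t')%N -> cylinders (cylinder t y `&` cylinder t' y').
  move=> tt'; case: (pselect (cylinder t y y')) => [yy'|nyy'].
    right; exists t', y'; apply/seteqP; split => [x []//|x xy']; split => //.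
    by move=> s st; rewrite xy' ?yy'//; exact: leq_trans tt'.
  left; apply/seteqP; split => [x [xy xy']|//]; apply: nyy' => s st.
  by rewrite -xy' ?xy//; exact: leq_trans tt'.
move=> _ _ [->|[t [y ->]]] [->|[t' [y' ->]]].
- by left; rewrite setI0.
- by left; rewrite set0I.
- by left; rewrite setI0.
- by case/orP: (leq_total t t') => H; [|rewrite setIC]; exact: aux.
Qed.

Lemma countable_measurable_preimage (d : measure_display)
    (T : measurableType d) (I : countType) (f : T -> I) (A : set I) :
  (forall i, measurable (f @^-1` [set i])) -> measurable (f @^-1` A).
Proof.
move=> mf; rewrite [X in measurable X](_ : _ =
    \bigcup_i (if i \in A then f @^-1` [set i] else set0)).
  apply: countable_bigcupT_measurable => // i; first by case: ifP.
apply/seteqP; split => [w Afw|w [i _]].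
  by exists (f w) => //; rewrite mem_set.
by case: ifPn => // /set_mem Ai /= ->.
Qed.

Lemma measurable_coord_eq (t : nat) (i : int) :
  measurable [set x : paths | x t = i].
Proof.
(* Finite words are countable, unlike reference paths, and every path lies in the cylinder of its
   own prefix. Words that are too short get padded with 0, which does no harm. *)
rewrite [X in measurable X](_ : _ = \bigcup_(l : seq int)
    (if nth 0 l t == i then cylinder t.+1 (nth 0 l) else set0)).
  apply: countable_bigcupT_measurable => // l; case: ifP => _ //.
  by apply: sub_sigma_algebra; right; exists t.+1, (nth 0 l).
apply/seteqP; split => [x xti|x [l _]].
  exists (mkseq x t.+1) => //; rewrite nth_mkseq// xti eqxx => s st.
  by rewrite nth_mkseq.
by case: eqP => // <- /(_ t); exact.
Qed.

Lemma measurable_coord (t : nat) (A : set int) :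
  measurable [set x : paths | A (x t)].
Proof.
exact: (@countable_measurable_preimage _ paths _ (fun x => x t) A
  (measurable_coord_eq t)).
Qed.

Lemma measurable_coord_fun (d : measure_display) (T : measurableType d)
    (t : nat) (f : int -> T) : measurable_fun setT (fun x : paths => f (x t)).
Proof. by move=> _ A mA; rewrite setTI; exact: measurable_coord (f @^-1` A). Qed.

Lemma measurable_to_paths (d : measure_display) (T : measurableType d)
    (f : T -> paths) :
  (forall t i, measurable [set w | f w t = i]) -> measurable_fun setT f.
Proof.
move=> mf; apply: (@measurability _ _ T paths setT f cylinders erefl).
move=> _ [_ [->|[t [y ->]]] <-]; rewrite setTI ?preimage_set0//.
(* The index [s = t], at which the whole space is intersected, keeps the family nonempty when
   [t = 0]. *)
rewrite [X in measurable X](_ : _ =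
  \bigcap_(s in [set s | (s < t.+1)%N])
     (if (s < t)%N then [set w | f w s = y s] else setT)).
  apply: bigcap_measurable; first by exists 0%N.
  by move=> s _; case: ifP.
apply/seteqP; split => [w fw s _|w fw s st].
  by case: ifPn => // st; exact: fw.
by have := fw s (leqW st); rewrite st.
Qed.

(** * Law of a nearest-neighbour walk driven by independent uniforms *)

Section Walk.
Context {R : realType} {d : measure_display} {T : measurableType d}.
Variables (P : probability T R) (U : nat -> T -> R).
Hypothesis hU : iid_uniform P U.
Implicit Types (p : int -> nat -> R) (k : int) (y : nat -> int).

(** The walk of the game sees the two strategies only through the chance [p] of an up step, so the
    probabilistic part is done for arbitrary [p]. *)
Fixpoint gwalk p k (t : nat) (w : T) : int :=
  match t with
  | 0%N => k
  | t'.+1 => let x := gwalk p k t' w in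
             if U t' w < p x t' then x + 1 else x - 1
  end.

Definition transition p := forall i t, 0 <= p i t <= 1.

Definition shift_time (f : int -> nat -> R) : int -> nat -> R :=
  fun i t => f i t.+1.

Definition cons_path k (x : nat -> int) : nat -> int :=
  fun t => if t is t'.+1 then x t' else k.

Definition step p (s : nat) (i j : int) : R :=
  if j == i + 1 then p i s else if j == i - 1 then 1 - p i s else 0.

(** The values of [U s] that carry the walk from [i] to [j]. They turn a condition on a path into
    separate conditions on the uniforms. *)
Definition step_set p (s : nat) (i j : int) : set R :=
  if j == i + 1 then `]-oo, p i s[%classic
  else if j == i - 1 then ~` `]-oo, p i s[%classic else set0.

Lemma measurable_step_set p s i j : measurable (step_set p s i j).
Proof.
rewrite /step_set; case: ifP => _; first exact: measurable_itv.
by case: ifP => _ //; apply: measurableC; exact: measurable_itv.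
Qed.

Lemma measurable_U (t : nat) (A : set R) : measurable A -> measurable (U t @^-1` A).
Proof.
by move=> mA; rewrite -[X in measurable X]setTI; case: hU => + _ _; apply.
Qed.

Lemma prob_step_set p s i j : transition p ->
  P (U s @^-1` step_set p s i j) = (step p s i j)%:E.
Proof.
move=> hp; have [_ hc _] := hU.
rewrite /step_set /step; case: ifP => _; first by rewrite hc.
case: ifP => _; last by rewrite preimage_set0 measure0.
rewrite preimage_setC probability_setC ?hc ?EFinB//.
exact: measurable_U (measurable_itv _).
Qed.

Lemma measurable_gwalk_eq p k t i : measurable [set w | gwalk p k t w = i].
Proof.
elim: t i => [|t IH] i.
  case: (eqVneq k i) => [->|ki].
    rewrite [X in measurable X](_ : _ = setT)//.
    by apply/seteqP; split.
  rewrite [X in measurable X](_ : _ = set0)//.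
  by apply/seteqP; split => // w /= /eqP; rewrite (negbTE ki).
rewrite [X in measurable X](_ : _ =
   ([set w | gwalk p k t w = i - 1] `&`
      U t @^-1` `]-oo, p (i - 1) t[%classic) `|`
   ([set w | gwalk p k t w = i + 1] `&`
      U t @^-1` (~` `]-oo, p (i + 1) t[%classic))).
  apply: measurableU; apply: measurableI => //; apply: measurable_U.
    exact: measurable_itv.
  by apply: measurableC; exact: measurable_itv.
apply/seteqP; split => w /=.
  case: ifPn => [h|h] <-; [left|right].
    by rewrite addrK in_itv.
  by rewrite subrK in_itv/=; split => //; exact/negP.
case=> -[->]; rewrite in_itv/=.
  by move=> ->; rewrite subrK.
by move=> /negP/negbTE ->; rewrite addrK.
Qed.

Lemma measurable_gwalk p k :
  measurable_fun setT (fun w => (gwalk p k ^~ w) : paths).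
Proof. by apply: measurable_to_paths => t i; exact: measurable_gwalk_eq. Qed.

Lemma measurable_cons_gwalk p k j :
  measurable_fun setT (fun w => cons_path j (gwalk p k ^~ w) : paths).
Proof.
apply: measurable_to_paths => -[|t] i /=; last exact: measurable_gwalk_eq.
exact: (measurable_gwalk_eq p j 0).
Qed.

(** A prescribed path tells which set each [U s] must hit, so a cylinder is an intersection of
    independent events. *)
Lemma gwalk_cylinder p k y t : transition p ->
  P [set w | cylinder t.+1 y (gwalk p k ^~ w)] =
  (if k == y 0%N then \prod_(0 <= s < t) step p s (y s) (y s.+1) else 0)%:E.
Proof.
move=> hp; case: eqP => [ky|ky]; last first.
  rewrite [X in P X](_ : _ = set0) ?measure0//.
  by apply/seteqP; split => // w /(_ 0%N erefl).
rewrite [X in P X](_ : _ = \big[setI/setT]_(0 <= s < t)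
     (U s @^-1` step_set p s (y s) (y s.+1))).
  have [_ _ hi] := hU.
  rewrite (hi _ (fun s => step_set p s (y s) (y s.+1))) ?iota_uniq//.
    by rewrite -prodEFin; apply: eq_bigr => s _; exact: prob_step_set.
  by move=> s; exact: measurable_step_set.
elim: t => [|t IH].
  rewrite big_nil; apply/seteqP; split => // w _ [|s]//.
rewrite big_nat_recr//= -IH; apply/seteqP; split => w /=.
  move=> h; split => [s st|]; first by apply: h; exact: leqW.
  have := h t.+1 (ltnSn _) => /=; rewrite h ?leqnSn// => <-.
  rewrite /step_set; case: ltP => h1; rewrite eqxx.
    by rewrite /= in_itv.
  have -> : (y t - 1 == y t + 1) = false by lia.
  by rewrite /= in_itv/= ltNge h1.
move=> [h1 h2] s; rewrite ltnS leq_eqVlt => /orP[/eqP ->|]; last exact: h1.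
rewrite /= h1//; move: h2; rewrite /step_set.
case: eqP => [->|_]; first by rewrite /= in_itv/= => ->.
by case: eqP => [->|//]; rewrite /= in_itv/= => /negP/negbTE ->.
Qed.

Lemma transition_shift p : transition p -> transition (shift_time p).
Proof. by move=> hp i t; exact: hp. Qed.

Lemma cons_gwalk_cylinder p k j y t :
  P [set w | cylinder t.+1 y (cons_path k (gwalk p j ^~ w))] =
  if k == y 0%N then P [set w | cylinder t (fun s => y s.+1) (gwalk p j ^~ w)]
  else 0%E.
Proof.
case: eqP => [ky|ky]; last first.
  rewrite [X in P X](_ : _ = set0) ?measure0//.
  by apply/seteqP; split => // w /(_ 0%N erefl).
congr (P _); apply/seteqP; split => w h.
  by move=> s st; exact: (h s.+1).
by move=> [|s] st //; exact: h.
Qed.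

Lemma cylinder0 y : cylinder 0 y = setT.
Proof. by apply/seteqP; split. Qed.

(** The restarted walks read the uniforms from [U 0] again, so the identity holds in law and not
    path by path. The law of the walk and the mixture of the two restarted laws agree on cylinders,
    a pi-system, hence on all measurable sets. *)
Lemma first_step p k (Phi : paths -> \bar R) : transition p ->
  measurable_fun [set: paths] Phi -> (forall x, 0 <= Phi x)%E ->
  (\int[P]_w Phi (gwalk p k ^~ w) =
   (p k 0%N)%:E *
     \int[P]_w Phi (cons_path k (gwalk (shift_time p) (k + 1) ^~ w)) +
   (1 - p k 0%N)%:E *
     \int[P]_w Phi (cons_path k (gwalk (shift_time p) (k - 1) ^~ w)))%E.
Proof.
move=> hp mPhi Phi0.
have /andP[p0 p1] := hp k 0%N.
have p1' : 0 <= 1 - p k 0%N by rewrite subr_ge0.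
pose f1 w := (gwalk p k ^~ w) : paths.
pose f2 j w := cons_path k (gwalk (shift_time p) j ^~ w) : paths.
have mf1 : measurable_fun setT f1 by exact: measurable_gwalk.
have mf2 j : measurable_fun setT (f2 j) by exact: measurable_cons_gwalk.
pose push f (mf : measurable_fun setT f) : {measure set paths -> \bar R} :=
  measure_function_pushforward__canonical__measure_function_Measure P mf.
pose M1 := push f1 mf1; pose M2 j := push (f2 j) (mf2 j).
pose M : {measure set paths -> \bar R} :=
  measure_add (mscale (NngNum p0) (M2 (k + 1)))
              (mscale (NngNum p1') (M2 (k - 1))).
have ME A : M A = ((p k 0%N)%:E * M2 (k + 1)%R A +
    (1 - p k 0%N)%:E * M2 (k - 1)%R A)%E by exact: measure_addE.
have eqM A : measurable A -> M1 A = M A.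
  move=> mA.
  apply: (@measure_unique _ R paths cylinders (fun=> setT) erefl
    cylinders_setI _ _ M1 M _ _ A mA).
  - by move=> _; right; exists 0%N, (fun=> 0); rewrite cylinder0.
  - by apply/seteqP; split => // x _; exists 0%N.
  - move=> _ [->|[[|t] [y ->]]]; first by rewrite !measure0.
      have PT f mf : push f mf setT = 1%E by exact: probability_setT.
      by rewrite ME cylinder0 !PT !mule1 -EFinD addrC subrK.
    rewrite ME.
    have -> : M1 (cylinder t.+1 y) =
        P [set w | cylinder t.+1 y (gwalk p k ^~ w)] by [].
    have E2 j : M2 j (cylinder t.+1 y) =
        P [set w | cylinder t.+1 y (cons_path k (gwalk (shift_time p) j ^~ w))].
      by [].
    rewrite !E2 gwalk_cylinder// !cons_gwalk_cylinder.
    case: eqP => [ky|_]; last by rewrite !mule0 adde0.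
    case: t {E2} => [|t].
      by rewrite big_nil cylinder0 probability_setT !mule1 -EFinD addrC subrK.
    rewrite !gwalk_cylinder; try exact: transition_shift.
    rewrite big_nat_recl//= -ky -!EFinM -EFinD; congr (_%:E).
    rewrite /step (eq_sym (k + 1)) (eq_sym (k - 1)).
    case: eqP => [->|_].
      have -> : (k + 1 == k - 1) = false by lia.
      by rewrite mulr0 addr0.
    by case: eqP => _; rewrite ?mul0r ?mulr0 ?add0r.
  - move=> _; have -> : M1 setT = 1%E by exact: probability_setT.
    exact: ltry.
have intE f mf : (\int[push f mf]_x Phi x = \int[P]_w Phi (f w))%E.
  by rewrite ge0_integral_pushforward.
rewrite -(intE f1 mf1) -(intE _ (mf2 (k + 1))) -(intE _ (mf2 (k - 1))).
rewrite (@eq_measure_integral _ _ _ _ M); last by move=> A mA _; exact: eqM.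
by rewrite /M ge0_integral_measure_add// !ge0_integral_mscale.
Qed.

End Walk.

(** * Escape probabilities and expected stakes *)

Definition tends_down : set (nat -> int) := [set x | limsup_is_ninfty x].
Definition tends_up : set (nat -> int) := [set x | liminf_is_pinfty x].

Lemma tends_down_up (x : nat -> int) : tends_down x -> ~ tends_up x.
Proof.
move=> /(_ 0)[N hN] /(_ 1)[N' hN'].
have := le_trans (hN' (maxn N N') (leq_maxr _ _)) (hN _ (leq_maxl _ _)).
by [].
Qed.

Lemma measurable_eventually (A : set int) :
  measurable [set x : paths | exists N : nat, forall t, (N <= t)%N -> A (x t)].
Proof.
rewrite [X in measurable X](_ : _ =
   \bigcup_(N : nat) \bigcap_(t : nat)
     (if (N <= t)%N then [set x : paths | A (x t)] else setT)).
  apply: bigcup_measurable => N _; apply: bigcapT_measurable => t.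
  by case: ifP => // _; exact: measurable_coord.
apply/seteqP; split => [x [N h]|x [N _ h]].
  by exists N => // t _; case: ifP => // ; exact: h.
by exists N => t Nt; have := h t I; rewrite Nt.
Qed.

Lemma measurable_tends_down : measurable (tends_down : set paths).
Proof.
rewrite [X in measurable X](_ : _ = \bigcap_(M : nat)
  [set x : paths | exists N : nat, forall t, (N <= t)%N -> x t <= - M%:Z]).
  by apply: bigcapT_measurable => M; exact: (measurable_eventually [set i | i <= - M%:Z]).
apply/seteqP; split => [x h M _|x h M]; first exact: h.
have [N hN] := h `|M|%N I; exists N => t /hN; lia.
Qed.

Lemma measurable_tends_up : measurable (tends_up : set paths).
Proof.
rewrite [X in measurable X](_ : _ = \bigcap_(M : nat)
  [set x : paths | exists N : nat, forall t, (N <= t)%N -> M%:Z <= x t]).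
  by apply: bigcapT_measurable => M; exact: (measurable_eventually [set i | M%:Z <= i]).
apply/seteqP; split => [x h M _|x h M]; first exact: h.
have [N hN] := h `|M|%N I; exists N => t /hN; lia.
Qed.

Lemma tends_down_cons k x : tends_down (cons_path k x) <-> tends_down x.
Proof.
split=> h M; have [N hN] := h M.
  by exists N => t Nt; apply: (hN t.+1); exact: leqW.
by exists N.+1 => -[//|t]; exact: hN.
Qed.

Lemma tends_up_cons k x : tends_up (cons_path k x) <-> tends_up x.
Proof.
split=> h M; have [N hN] := h M.
  by exists N => t Nt; apply: (hN t.+1); exact: leqW.
by exists N.+1 => -[//|t]; exact: hN.
Qed.

Lemma measurable_total_stake {R : realType} (c : int -> nat -> R) :
  strategy c -> measurable_fun [set: paths] (total_stake c).
Proof.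
move=> c0; rewrite /total_stake.
apply: (@ge0_emeasurable_sum _ paths R setT (fun t x => (c (x t) t)%:E) xpredT).
  by move=> t x _ _; rewrite lee_fin; exact: c0.
move=> t _; exact: (measurable_coord_fun t (fun i => (c i t)%:E)).
Qed.

Lemma total_stake_ge0 {R : realType} (c : int -> nat -> R) x :
  strategy c -> (0 <= total_stake c x)%E.
Proof. by move=> c0; apply: nneseries_ge0 => t _ _; rewrite lee_fin; exact: c0. Qed.

Lemma total_stake_cons {R : realType} (c : int -> nat -> R) k x :
  strategy c ->
  total_stake c (cons_path k x) = ((c k 0%N)%:E + total_stake (shift_time c) x)%E.
Proof.
move=> c0; rewrite /total_stake nneseries_recl//; last first.
  by move=> t _; rewrite lee_fin; exact: c0.
congr (_ + _)%E; rewrite -nneseries_addn; last first.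
  by move=> t; rewrite lee_fin; exact: c0.
by apply: eq_eseriesr => t _; rewrite addn1.
Qed.

Section WalkLaw.
Context {R : realType} {d : measure_display} {T : measurableType d}.
Variables (P : probability T R) (U : nat -> T -> R).
Hypothesis hU : iid_uniform P U.
Implicit Types (p c : int -> nat -> R) (g : int -> R) (k : int).

Local Notation X := (gwalk U).

Definition Eat p k t g : \bar R := (\int[P]_w (g (X p k t w))%:E)%E.
(** Kept in the extended reals, since a deviating strategy may have infinite expected cost. *)
Definition Estake c p k : \bar R := (\int[P]_w total_stake c (X p k ^~ w))%E.
Definition event_down p k : set T := [set w | tends_down (X p k ^~ w)].
Definition event_up p k : set T := [set w | tends_up (X p k ^~ w)].
Definition Pdown p k : R := fine (P (event_down p k)).
Definition Pup p k : R := fine (P (event_up p k)).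

Lemma integral_prob_cst (r : R) : (\int[P]_w r%:E = r%:E)%E.
Proof.
rewrite integral_cst// -[RHS]mule1; congr (_ * _)%E; exact: probability_setT.
Qed.

Lemma measurable_gwalk_fun d' (Y : measurableType d') p k (f : paths -> Y) :
  measurable_fun setT f -> measurable_fun setT (fun w => f (X p k ^~ w)).
Proof.
by move=> mf; exact: (measurableT_comp mf (measurable_gwalk hU p k)).
Qed.

Lemma measurable_at d' (Y : measurableType d') p k t (f : int -> Y) :
  measurable_fun setT (fun w => f (X p k t w)).
Proof. exact: (measurable_gwalk_fun p k (measurable_coord_fun t f)). Qed.

Lemma measurable_stake c p k : strategy c ->
  measurable_fun setT (fun w => total_stake c (X p k ^~ w)).
Proof. by move=> /measurable_total_stake; exact: measurable_gwalk_fun. Qed.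

Lemma measurable_event_down p k : measurable (event_down p k).
Proof.
have := measurable_gwalk hU p k measurableT measurable_tends_down.
by rewrite setTI.
Qed.

Lemma measurable_event_up p k : measurable (event_up p k).
Proof.
have := measurable_gwalk hU p k measurableT measurable_tends_up.
by rewrite setTI.
Qed.

Lemma PdownE p k : P (event_down p k) = (Pdown p k)%:E.
Proof. by rewrite /Pdown fineK// fin_num_measure//; exact: measurable_event_down. Qed.

Lemma PupE p k : P (event_up p k) = (Pup p k)%:E.
Proof. by rewrite /Pup fineK// fin_num_measure//; exact: measurable_event_up. Qed.

Lemma Pdown_ge0 p k : 0 <= Pdown p k.
Proof. exact: fine_ge0. Qed.

Lemma Pup_ge0 p k : 0 <= Pup p k.
Proof. exact: fine_ge0. Qed.

Lemma Pdown_Pup_le1 p k : Pdown p k + Pup p k <= 1.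
Proof.
rewrite -lee_fin EFinD -PdownE -PupE -measureU.
- exact/probability_le1/measurableU/measurable_event_up/measurable_event_down.
- exact: measurable_event_down.
- exact: measurable_event_up.
- by apply/seteqP; split => // w [/tends_down_up].
Qed.

Lemma Eat_ge0 p k t g : (forall i, 0 <= g i) -> (0 <= Eat p k t g)%E.
Proof. by move=> g0; apply: integral_ge0 => w _; rewrite lee_fin. Qed.

Lemma Estake_ge0 c p k : strategy c -> (0 <= Estake c p k)%E.
Proof. by move=> c0; apply: integral_ge0 => w _; exact: total_stake_ge0. Qed.

(** An event that ignores the prepended site has an indicator to which the first-step decomposition
    applies without a trace of [k]. *)
Lemma prob_mix p k (A : set paths) :
  transition p -> measurable A ->
  (forall x, A (cons_path k x) <-> A x) ->
  P [set w | A (X p k ^~ w)] =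
  ((p k 0%N)%:E * P [set w | A (X (shift_time p) (k + 1) ^~ w)] +
   (1 - p k 0%N)%:E * P [set w | A (X (shift_time p) (k - 1) ^~ w)])%E.
Proof.
move=> hp mA hA.
have mAX q j : measurable [set w | A (X q j ^~ w)].
  by have := measurable_gwalk hU q j measurableT mA; rewrite setTI.
have E q j : P [set w | A (X q j ^~ w)] = (\int[P]_w (\1_A (X q j ^~ w))%:E)%E.
  transitivity (\int[P]_w (\1_[set w | A (X q j ^~ w)] w)%:E)%E.
    by rewrite integral_indic// setIT.
  by apply: eq_integral => w _; rewrite !indicE; congr ((_ : bool)%:R%:E);
    apply/idP/idP => /set_mem/mem_set.
have cE x : (\1_A (cons_path k x) : R) = \1_A x.
  rewrite !indicE; congr ((_ : bool)%:R).
  by apply/idP/idP => /set_mem h; apply/mem_set; apply/hA.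
rewrite !E (first_step (p := p) hU k (Phi := fun x => (\1_A x)%:E))//.
- by congr (_ * _ + _ * _)%E; apply: eq_integral => w _; rewrite cE.
- exact/measurable_EFinP/measurable_indic.
Qed.

Lemma Pdown_step p k : transition p ->
  Pdown p k = p k 0%N * Pdown (shift_time p) (k + 1) +
              (1 - p k 0%N) * Pdown (shift_time p) (k - 1).
Proof.
move=> hp; apply: EFin_inj; rewrite EFinD !EFinM -!PdownE.
exact: prob_mix hp measurable_tends_down (tends_down_cons k).
Qed.

Lemma Pup_step p k : transition p ->
  Pup p k = p k 0%N * Pup (shift_time p) (k + 1) +
              (1 - p k 0%N) * Pup (shift_time p) (k - 1).
Proof.
move=> hp; apply: EFin_inj; rewrite EFinD !EFinM -!PupE.
exact: prob_mix hp measurable_tends_up (tends_up_cons k).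
Qed.

Lemma Estake_step c p k : transition p -> strategy c ->
  Estake c p k = ((c k 0%N)%:E +
    ((p k 0%N)%:E * Estake (shift_time c) (shift_time p) (k + 1) +
     (1 - p k 0%N)%:E * Estake (shift_time c) (shift_time p) (k - 1)))%E.
Proof.
move=> hp c0; have c0' : strategy (shift_time c) by move=> i t; exact: c0.
have /andP[p0 p1] := hp k 0%N.
rewrite /Estake (first_step (p := p) hU k (Phi := total_stake c))//; last 2 first.
- exact: measurable_total_stake.
- by move=> x; exact: total_stake_ge0.
have E j : (\int[P]_w total_stake c (cons_path k (X (shift_time p) j ^~ w)) =
   (c k 0%N)%:E + Estake (shift_time c) (shift_time p) j)%E.
  under eq_integral do rewrite total_stake_cons//.
  rewrite ge0_integralD//.
  - by rewrite integral_prob_cst.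
  - by move=> w _; rewrite lee_fin.
  - by move=> w _; exact: total_stake_ge0.
  - exact: measurable_stake.
have e0 j : (0 <= Estake (shift_time c) (shift_time p) j)%E by exact: Estake_ge0.
have ck0 : (0 <= (c k 0%N)%:E)%E by rewrite lee_fin.
rewrite !E (ge0_muleDr _ ck0 (e0 _)) (ge0_muleDr _ ck0 (e0 _)).
rewrite addeACA; congr (_ + _)%E.
by rewrite -ge0_muleDl ?lee_fin ?subr_ge0// -EFinD addrC subrK mul1e.
Qed.

Lemma Eat0 p k g : Eat p k 0 g = (g k)%:E.
Proof. by rewrite /Eat /= integral_prob_cst. Qed.

Lemma Eat_step p k t g : transition p -> (forall i, 0 <= g i) ->
  Eat p k t.+1 g = ((p k 0%N)%:E * Eat (shift_time p) (k + 1) t g +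
                    (1 - p k 0%N)%:E * Eat (shift_time p) (k - 1) t g)%E.
Proof.
move=> hp g0; rewrite /Eat (first_step (p := p) hU k (Phi := fun x => (g (x t.+1))%:E))//.
  exact: (measurable_coord_fun t.+1 (fun i => (g i)%:E)).
by move=> x; rewrite lee_fin.
Qed.

(** The transition operator of the walk at time [t]. *)
Definition advance p t g : int -> R :=
  fun i => p i t * g (i + 1) + (1 - p i t) * g (i - 1).

(** First-step decomposition peels the walk at its beginning; induction on [t] turns this into
    peeling the last step, the form that martingale arguments use. *)
Lemma Eat_forward p k t g : transition p -> (forall i, 0 <= g i) ->
  Eat p k t.+1 g = Eat p k t (advance p t g).
Proof.
elim: t p k g => [|t IH] p k g hp g0.
  by rewrite Eat_step// !Eat0.
have hp' := transition_shift hp.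
rewrite Eat_step// [RHS]Eat_step//; first by rewrite !IH.
move=> i; have /andP[p0 p1] := hp i t.+1.
by rewrite addr_ge0// mulr_ge0// subr_ge0.
Qed.

Lemma EatD p k t g g' : (forall i, 0 <= g i) -> (forall i, 0 <= g' i) ->
  Eat p k t (fun i => g i + g' i) = (Eat p k t g + Eat p k t g')%E.
Proof.
move=> g0 g'0; rewrite /Eat.
under eq_integral do rewrite EFinD.
rewrite ge0_integralD//.
- by move=> w _; rewrite lee_fin.
- exact: (measurable_at _ _ _ (fun i => (g i)%:E)).
- by move=> w _; rewrite lee_fin.
- exact: (measurable_at _ _ _ (fun i => (g' i)%:E)).
Qed.

Lemma Eat_le p k t g g' : (forall i, 0 <= g i) -> (forall i, g i <= g' i) ->
  (Eat p k t g <= Eat p k t g')%E.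
Proof.
move=> g0 gg'; apply: ge0_le_integral => //.
- by move=> w _; rewrite lee_fin.
- exact: (measurable_at _ _ _ (fun i => (g i)%:E)).
- exact: (measurable_at _ _ _ (fun i => (g' i)%:E)).
- by move=> w _; rewrite lee_fin.
Qed.

Lemma Eat_cst p k t (r : R) : Eat p k t (fun=> r) = r%:E.
Proof. by rewrite /Eat integral_prob_cst. Qed.

Lemma Estake_series c p k : strategy c ->
  Estake c p k = (\sum_(0 <= t <oo) Eat p k t (c ^~ t))%E.
Proof.
move=> c0; rewrite /Estake /total_stake integral_nneseries//.
- by move=> t; exact: (measurable_at _ _ _ (fun i => (c i t)%:E)).
- by move=> t w _; rewrite lee_fin; exact: c0.
Qed.

End WalkLaw.

(** * Optional stopping at infinity *)

Definition nearest_neighbour (x : nat -> int) :=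
  forall t, x t.+1 = x t + 1 \/ x t.+1 = x t - 1.

Definition eventually_in (A : int -> Prop) (x : nat -> int) :=
  exists N : nat, forall t, (N <= t)%N -> A (x t).

Lemma eventually_inI (A B : int -> Prop) x :
  eventually_in A x -> eventually_in B x ->
  eventually_in (fun i => A i /\ B i) x.
Proof.
move=> [N hN] [N' hN']; exists (maxn N N') => t.
by rewrite geq_max => /andP[/hN ? /hN' ?].
Qed.

(** A path with unit steps cannot jump over [i]. *)
Lemma leave_side (x : nat -> int) (i : int) : nearest_neighbour x ->
  eventually_in (fun j => j <> i) x ->
  eventually_in (fun j => i < j) x \/ eventually_in (fun j => j < i) x.
Proof.
move=> nx [N hN]; have [xN|xN|xN] := ltgtP i (x N); last first.
- by have := hN N (leqnn N); rewrite xN.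
- right; exists N => t Nt; rewrite -(subnK Nt).
  elim: (t - N)%N => [//|s IH]; rewrite addSn.
  have := hN (s + N).+1 (leqW (leq_addl _ _)).
  by move: IH; case: (nx (s + N)%N) => ->; lia.
- left; exists N => t Nt; rewrite -(subnK Nt).
  elim: (t - N)%N => [//|s IH]; rewrite addSn.
  have := hN (s + N).+1 (leqW (leq_addl _ _)).
  by move: IH; case: (nx (s + N)%N) => ->; lia.
Qed.

(** Once the path has left 0 for good it stays on one side; leaving the further sites of that side
    one after the other pushes it to infinity. *)
Lemma transient_tends (x : nat -> int) : nearest_neighbour x ->
  (forall i, eventually_in (fun j => j <> i) x) -> tends_down x \/ tends_up x.
Proof.
move=> nx hx; have [h|h] := leave_side nx (hx 0); [right|left].
  have H (M : nat) : eventually_in (fun j => M%:Z < j) x.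
    elim: M => // M /eventually_inI /(_ (hx (M.+1)%:Z)) [N hN]; exists N => t /hN; lia.
  by move=> M; have [N hN] := H `|M|%N; exists N => t /hN; lia.
have H (M : nat) : eventually_in (fun j => j < - M%:Z) x.
  elim: M => // M /eventually_inI /(_ (hx (- (M.+1)%:Z))) [N hN]; exists N => t /hN; lia.
by move=> M; have [N hN] := H `|M|%N; exists N => t /hN; lia.
Qed.

(** Each visit to [i] costs the same positive amount, so infinitely many visits would exceed any
    finite total. *)
Lemma finite_stake_transient {R : realType} (c : int -> R) (x : nat -> int) :
  (forall i, 0 < c i) -> (total_stake (ti_mina c) x < +oo)%E ->
  forall i, eventually_in (fun j => j <> i) x.
Proof.
move=> c0 fin i; apply: contrapT => nev.
have io (N : nat) : exists2 t, (N <= t)%N & x t = i.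
  apply: contrapT => h; apply: nev; exists N => t Nt xt.
  by apply: h; exists t.
have large (n : nat) : exists k, c i *+ n <= \sum_(0 <= t < k) c (x t).
  elim: n => [|n [k hk]]; first by exists 0%N; rewrite mulr0n big_nil.
  have [t kt xt] := io k; exists t.+1.
  rewrite big_nat_recr//= xt mulrSr lerD2r (le_trans hk)//.
  rewrite [leRHS](big_cat_nat _ kt)//= lerDl sumr_ge0// => j _; exact: ltW.
have tot0 : (0 <= total_stake (ti_mina c) x)%E.
  by apply: total_stake_ge0 => j t; rewrite /ti_mina ltW.
have le_tot k : \sum_(0 <= t < k) c (x t) <= fine (total_stake (ti_mina c) x).
  rewrite -lee_fin fineK ?ge0_fin_numE// -sumEFin.
  by apply: nneseries_lim_ge => j _ _; rewrite lee_fin ltW// /ti_mina.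
(* A number of visits whose cost alone exceeds the total stake. *)
have [k hk] := large (Num.bound (fine (total_stake (ti_mina c) x) / c i)).
have := le_trans hk (le_tot k); apply/negP; rewrite -ltNge.
rewrite -mulr_natl -ltr_pdivrMr//.
by apply: archi_boundP; rewrite divr_ge0 ?fine_ge0// ltW.
Qed.

Lemma tends_down_lim {R : realType} (g : int -> R) (l : R) x :
  lim_ninfty g l -> tends_down x -> g (x t) @[t --> \oo] --> l.
Proof.
move=> /cvgrPdist_lt gl dx; apply/cvgrPdist_lt => e /gl [K _ hK].
have [N hN] := dx (- K%:Z); exists N => // t /hN xt.
have := hK `|x t|%N; have -> : - `|x t|%N%:Z = x t by lia.
by apply => /=; lia.
Qed.

Lemma tends_up_lim {R : realType} (g : int -> R) (l : R) x :
  lim_pinfty g l -> tends_up x -> g (x t) @[t --> \oo] --> l.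
Proof.
move=> /cvgrPdist_lt gl dx; apply/cvgrPdist_lt => e /gl [K _ hK].
have [N hN] := dx K%:Z; exists N => // t /hN xt.
have := hK `|x t|%N; have -> : `|x t|%N%:Z = x t by lia.
by apply => /=; lia.
Qed.

Lemma limn_einf_le {R : realType} (u : (\bar R)^nat) (r : \bar R) :
  (forall n, u n <= r)%E -> (limn_einf u <= r)%E.
Proof.
move=> ur; rewrite limn_einf_lim; apply: lime_le; first exact: is_cvg_einfs.
apply: nearW => n; apply: le_trans (ur n); apply: ereal_inf_lbound.
by exists n => /=.
Qed.

Lemma probability_full {R : realType} (d : measure_display)
    (T : measurableType d) (P : probability T R) (C : set T) :
  measurable C -> P.-negligible (~` C) -> P C = 1%E.
Proof.
move=> mC /(measure_negligible (measurableC mC)) h.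
have fC := fin_num_measure P _ mC.
have := probability_setC P mC; rewrite h -(fineK fC) -EFinB => -[].
by move=> /esym/eqP; rewrite subr_eq0 => /eqP e; rewrite -(fineK fC) -e.
Qed.

Section WalkValue.
Context {R : realType} {d : measure_display} {T : measurableType d}.
Variables (P : probability T R) (U : nat -> T -> R).
Hypothesis hU : iid_uniform P U.
Implicit Types (p c : int -> nat -> R) (g : int -> R) (k : int).

Local Notation X := (gwalk U).
Local Notation A := (event_down U).
Local Notation B := (event_up U).

Lemma gwalk_nearest p k w : nearest_neighbour (X p k ^~ w).
Proof. by move=> t /=; case: ifP => _; [left|right]. Qed.

Lemma integrable_indic_prob (C : set T) : measurable C ->
  P.-integrable setT (EFin \o \1_C).
Proof.
move=> mC; apply: (@le_integrable _ _ _ P _ measurableT _ (EFin \o cst 1)).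
- exact/measurable_EFinP/measurable_indic.
- by move=> w _ /=; rewrite indicE; case: (_ \in _); rewrite ?normr0 ?normr1// lee_fin.
- exact: finite_measure_integrable_cst.
Qed.

Lemma integral_two_indic (C D : set T) (u v : R) : measurable C -> measurable D ->
  (\int[P]_w (u * \1_C w + v * \1_D w)%:E = u%:E * P C + v%:E * P D)%E.
Proof.
move=> mC mD.
under eq_integral do rewrite EFinD !EFinM.
rewrite integralD//.
- rewrite !integralZl//; try exact: integrable_indic_prob.
  by rewrite !integral_indic// !setIT.
- by apply: integrableZl => //; exact: integrable_indic_prob.
- by apply: integrableZl => //; exact: integrable_indic_prob.
Qed.

(* Fatou's lemma, restricted to the paths that tend to one of the two ends. *)
Lemma Eat_fatou p k g vd vu (r : R) (t0 : nat) :
  (forall i, 0 <= g i) -> lim_ninfty g vd -> lim_pinfty g vu ->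
  (forall t, (t0 <= t)%N -> (Eat P U p k t g <= r%:E)%E) ->
  vd * Pdown P U p k + vu * Pup P U p k <= r.
Proof.
move=> g0 gd gu Er.
have mA := measurable_event_down hU p k.
have mB := measurable_event_up hU p k.
(* The indicator removes the paths along which [g] may have no limit, so that [f] converges
   everywhere; the shift by [t0] makes the bound hold from the first index on. *)
pose f t w : \bar R := (g (X p k (t + t0)%N w) * \1_(A p k `|` B p k) w)%:E.
have f0 t w : (0 <= f t w)%E.
  by rewrite lee_fin mulr_ge0// indicE; case: (_ \in _).
have mf t : measurable_fun setT (f t).
  apply/measurable_EFinP; apply: measurable_funM.
    exact: (measurable_at hU p k (t + t0)%N g).
  exact/measurable_indic/measurableU.
have fcvg w : f ^~ w @ \oo --> (vd * \1_(A p k) w + vu * \1_(B p k) w)%:E.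
  apply: cvg_EFin; first by apply: nearW.
  rewrite /f /= !indicE.
  have [Aw|Aw] := pselect (A p k w).
    have nB : ~ B p k w by move=> /tends_down_up; apply.
    have ABw : (A p k `|` B p k) w by left.
    rewrite (mem_set Aw) (memNset nB) (mem_set ABw) mulr0 addr0.
    rewrite mulr1; under eq_fun do rewrite mulr1.
    by have := tends_down_lim gd Aw; rewrite -(cvg_shiftn t0).
  have [Bw|Bw] := pselect (B p k w).
    have ABw : (A p k `|` B p k) w by right.
    rewrite (memNset Aw) (mem_set Bw) (mem_set ABw) mulr0 add0r.
    rewrite mulr1; under eq_fun do rewrite mulr1.
    by have := tends_up_lim gu Bw; rewrite -(cvg_shiftn t0).
  have nAB : ~ (A p k `|` B p k) w by case.
  rewrite (memNset Aw) (memNset Bw) (memNset nAB) !mulr0 addr0.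
  under eq_fun do rewrite mulr0.
  exact: cvg_cst.
rewrite -lee_fin EFinD !EFinM -PdownE// -PupE// -integral_two_indic//.
have -> : (\int[P]_w (vd * \1_(A p k) w + vu * \1_(B p k) w)%:E =
           \int[P]_w limn_einf (f ^~ w))%E.
  by apply: eq_integral => w _; rewrite (cvg_limn_einf_sup (fcvg w)).1.
apply: le_trans (fatou _ _ _ _) _ => //.
apply: limn_einf_le => t; apply: le_trans (Er (t + t0)%N (leq_addl _ _)).
apply: ge0_le_integral => //.
- exact: (measurable_at hU _ _ _ (fun i => (g i)%:E)).
- move=> w _; rewrite lee_fin ler_piMr// indicE; by case: (_ \in _).
Qed.

(* [g (X_t)] minus the stakes spent so far is a supermartingale. *)
Lemma Eat_upper p c k g t : transition p -> strategy c ->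
  (forall i, 0 <= g i) ->
  (forall i t, p i t * g (i + 1) + (1 - p i t) * g (i - 1) <= g i + c i t) ->
  (Eat P U p k t g <= (g k)%:E + \sum_(0 <= s < t) Eat P U p k s (c ^~ s))%E.
Proof.
move=> hp c0 g0 hg; elim: t => [|t IH].
  by rewrite Eat0 big_nil adde0.
rewrite Eat_forward// big_nat_recr//= addeA.
apply: le_trans (leeD2r _ IH).
rewrite -EatD//; apply: Eat_le => // i; last exact: hg.
by have /andP[? ?] := hp i t; rewrite addr_ge0// mulr_ge0// subr_ge0.
Qed.

Lemma Eat_exact p c k g t : transition p -> strategy c ->
  (forall i, 0 <= g i) ->
  (forall i t, p i t * g (i + 1) + (1 - p i t) * g (i - 1) = g i + c i t) ->
  (Eat P U p k t g = (g k)%:E + \sum_(0 <= s < t) Eat P U p k s (c ^~ s))%E.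
Proof.
move=> hp c0 g0 hg; elim: t => [|t IH].
  by rewrite Eat0 big_nil adde0.
rewrite Eat_forward// big_nat_recr//= addeA -IH -EatD//.
by congr Eat; apply/funext => i; exact: hg.
Qed.

(** With [g] the value of a player and [c] any stakes of that player, no deviation collects more at
    the two ends than [g k] plus its cost. An infinite cost makes this trivial; otherwise Fatou's
    lemma passes to the limit in [Eat_upper]. *)
Lemma terminal_bound p c k g vd vu : transition p -> strategy c ->
  (forall i, 0 <= g i) -> lim_ninfty g vd -> lim_pinfty g vu ->
  (forall i t, p i t * g (i + 1) + (1 - p i t) * g (i - 1) <= g i + c i t) ->
  ((vd * Pdown P U p k + vu * Pup P U p k)%:E <=
     (g k)%:E + Estake P U c p k)%E.
Proof.
move=> hp c0 g0 gd gu hg.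
have S0 := Estake_ge0 P U p k c0.
have [Sfin|] := boolP (Estake P U c p k \is a fin_num); last first.
  by rewrite ge0_fin_numE// -leNgt leye_eq => /eqP ->; rewrite addey// leey.
rewrite -(fineK Sfin) -EFinD lee_fin.
apply: (@Eat_fatou p k g vd vu _ 0) => // t _.
rewrite EFinD fineK// Estake_series//; apply: le_trans (Eat_upper _ _ hp c0 g0 hg) _.
by rewrite leeD2l// nneseries_lim_ge// => s _ _; exact: Eat_ge0.
Qed.

(** Boundedness of [g] bounds the expected total stake, which is then almost surely finite, so the
    walk escapes to an end. Fatou's lemma for [g] and for [b - g] gives the two inequalities. *)
Lemma terminal_exact p (c : int -> R) k g vd vu (b : R) : transition p ->
  (forall i, 0 < c i) ->
  (forall i, 0 <= g i <= b) -> lim_ninfty g vd -> lim_pinfty g vu ->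
  (forall i t, p i t * g (i + 1) + (1 - p i t) * g (i - 1) = g i + c i) ->
  Pdown P U p k + Pup P U p k = 1 /\
  (Estake P U (ti_mina c) p k =
   (vd * Pdown P U p k + vu * Pup P U p k - g k)%:E)%E.
Proof.
move=> hp cp gb gd gu hg.
have c0 : strategy (ti_mina c) by move=> i t; rewrite /ti_mina ltW.
have g0 i : 0 <= g i by have /andP[] := gb i.
have E t := Eat_exact k t hp c0 g0 hg.
have e0 s : (0 <= Eat P U p k s c)%E by apply: Eat_ge0 => i; exact: ltW.
have Eb t : (Eat P U p k t g <= b%:E)%E.
  by rewrite -(Eat_cst P U p k t b); apply: Eat_le => // i; have /andP[] := gb i.
have Sb : (Estake P U (ti_mina c) p k <= b%:E)%E.
  rewrite Estake_series//; apply: lime_le; first exact: is_cvg_nneseries.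
  apply: nearW => t; apply: le_trans (Eb t); rewrite E.
  by apply: leeDr; rewrite lee_fin.
have S0 := Estake_ge0 P U p k c0.
have Sfin : (Estake P U (ti_mina c) p k < +oo)%E.
  by apply: le_lt_trans Sb _; exact: ltry.
have AB1 : Pdown P U p k + Pup P U p k = 1.
  have mA := measurable_event_down hU p k.
  have mB := measurable_event_up hU p k.
  apply: EFin_inj; rewrite EFinD -PdownE// -PupE// -measureU//; last first.
    by apply/seteqP; split => // w [/tends_down_up].
  have mAB : measurable (A p k `|` B p k) by exact: measurableU.
  apply: probability_full => //.
  have : P.-integrable setT (fun w => total_stake (ti_mina c) (X p k ^~ w)).
    apply/integrableP; split; first exact: (measurable_stake hU p k c0).
    by under eq_integral do rewrite gee0_abs ?total_stake_ge0//.
  move=> /(integrable_ae measurableT); apply: negligibleS => w /= nAB fin.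
  apply: nAB; apply: transient_tends; first exact: gwalk_nearest.
  apply: (finite_stake_transient cp); have := fin I.
  by rewrite ge0_fin_numE// total_stake_ge0.
split => //.
set V := vd * _ + vu * _.
have geV : (V%:E <= (g k)%:E + Estake P U (ti_mina c) p k)%E.
  by apply: terminal_bound => // i t; rewrite hg.
have Efin t : Eat P U p k t g \is a fin_num.
  by rewrite ge0_fin_numE ?Eat_ge0//; apply: le_lt_trans (Eb t) (ltry _).
have Ele t0 t : (t0 <= t)%N -> (Eat P U p k t0 g <= Eat P U p k t g)%E.
  move=> t0t; rewrite !E leeD2l//.
  by rewrite [leRHS](big_cat_nat _ t0t)//= leeDl// sume_ge0.
(* Fatou for [b - g] gives the reverse of the bound [geV]. *)
have leV t0 : (Eat P U p k t0 g <= V%:E)%E.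
  have bg0 i : 0 <= b - g i by rewrite subr_ge0; have /andP[] := gb i.
  have bgd : lim_ninfty (fun i => b - g i) (b - vd).
    by apply: cvgB => //; exact: cvg_cst.
  have bgu : lim_pinfty (fun i => b - g i) (b - vu).
    by apply: cvgB => //; exact: cvg_cst.
  have Ebg t : Eat P U p k t (fun i => b - g i) =
               (b - fine (Eat P U p k t g))%:E.
    have := EatD hU p k t bg0 g0.
    under eq_fun do rewrite subrK.
    rewrite Eat_cst EFinB fineK// => ->.
    by rewrite addeK.
  have h := @Eat_fatou p k _ _ _ (b - fine (Eat P U p k t0 g)) t0 bg0 bgd bgu.
  have {h} : (b - vd) * Pdown P U p k + (b - vu) * Pup P U p k <=
       b - fine (Eat P U p k t0 g).
    apply: h => t t0t; rewrite Ebg lee_fin lerD2l lerN2.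
    by apply: fine_le => //; exact: Ele.
  rewrite -(fineK (Efin t0)) lee_fin /V.
  move: (Pdown P U p k) (Pup P U p k) AB1 => al be albe.
  by have -> : be = 1 - al; [lra|nra].
apply/eqP; rewrite eq_le; apply/andP; split; last first.
  by rewrite EFinB leeBlDl.
rewrite Estake_series//; apply: lime_le; first exact: is_cvg_nneseries.
by apply: nearW => t; have := leV t; rewrite E EFinB leeBrDl.
Qed.

Lemma terminalE (vd vu vs : R) p k w :
  terminal vd vu vs (X p k ^~ w) =
  (vs + ((vd - vs) * \1_(A p k) w + (vu - vs) * \1_(B p k) w))%:E.
Proof.
rewrite /terminal !indicE; case: asboolP => [Aw|nA].
  have nB : ~ B p k w by move=> /tends_down_up; apply.
  by rewrite (memNset nB) (mem_set (Aw : A p k w)); congr (_%:E) => /=; lra.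
case: asboolP => [Bw|nB].
  rewrite (mem_set (Bw : B p k w)) (memNset (nA : ~ A p k w)).
  by congr (_%:E) => /=; lra.
rewrite (memNset (nB : ~ B p k w)) (memNset (nA : ~ A p k w)).
by congr (_%:E) => /=; lra.
Qed.

(** The terminal payment is bounded, so the delicate case is an infinite expected stake: there the
    positive part of the payoff is bounded, its negative part has infinite integral, and both sides
    are [-oo]. *)
Lemma integral_payoff c (vd vu vs : R) p k : strategy c ->
  (\int[P]_w (- total_stake c (X p k ^~ w) + terminal vd vu vs (X p k ^~ w)) =
   (vd * Pdown P U p k + vu * Pup P U p k
      + vs * (1 - Pdown P U p k - Pup P U p k))%:E - Estake P U c p k)%E.
Proof.
move=> c0; have mA := measurable_event_down hU p k.
have mB := measurable_event_up hU p k.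
pose tau w : R := (vd - vs) * \1_(A p k) w + (vu - vs) * \1_(B p k) w.
have mtau : measurable_fun setT tau.
  by apply: measurable_funD; apply: measurable_funM => //; exact: measurable_indic.
pose D := `|vd| + `|vu| + `|vs|.
have tauD w : `|vs + tau w| <= D.
  rewrite /tau !indicE /D.
  have [Aw|nA] := pselect (A p k w); have [Bw|nB] := pselect (B p k w).
  - by exfalso; move: Bw; apply/tends_down_up.
  - rewrite (mem_set Aw) (memNset nB) mulr1 mulr0 addr0 addrC subrK.
    by rewrite -addrA lerDl addr_ge0.
  - rewrite (mem_set Bw) (memNset nA) mulr1 mulr0 add0r addrC subrK.
    by rewrite -addrA addrCA lerDl addr_ge0.
  - by rewrite (memNset nA) (memNset nB) !mulr0 !addr0 lerDr addr_ge0.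
have D0 : 0 <= D by rewrite !addr_ge0.
have itau : P.-integrable setT (fun w => (vs + tau w)%:E).
  apply: (@le_integrable _ _ _ P _ measurableT _ (EFin \o cst D)).
  - by apply/measurable_EFinP; exact: measurable_funD.
  - by move=> w _ /=; rewrite lee_fin (ger0_norm D0).
  - exact: finite_measure_integrable_cst.
under eq_integral do rewrite terminalE -/(tau _).
have mtot := measurable_stake hU p k c0.
have tot0 w : (0 <= total_stake c (X p k ^~ w))%E by exact: total_stake_ge0.
have Etau : (\int[P]_w (vs + tau w)%:E =
   (vd * Pdown P U p k + vu * Pup P U p k
      + vs * (1 - Pdown P U p k - Pup P U p k))%:E)%E.
  under eq_integral do rewrite EFinD.
  rewrite integralD//; last 2 first.
  - exact: finite_measure_integrable_cst.
  - apply: (eq_integrable measurableT (fun w => (vs + tau w)%:E + (- vs)%:E)%E).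
      by move=> w _; rewrite -EFinD; congr (_%:E); lra.
    apply: integrableD => //; exact: finite_measure_integrable_cst.
  rewrite integral_prob_cst integral_two_indic// PdownE// PupE//.
  by rewrite -!EFinM -!EFinD; congr (_%:E); lra.
have [Sfin|] := boolP (Estake P U c p k \is a fin_num).
  have itot : P.-integrable setT (fun w => total_stake c (X p k ^~ w)).
    apply/integrableP; split => //.
    under eq_integral do rewrite gee0_abs//.
    by rewrite -ge0_fin_numE// Estake_ge0.
  by under eq_integral do rewrite addeC; rewrite integralB// Etau.
rewrite ge0_fin_numE ?Estake_ge0// -leNgt leye_eq => /eqP Sy.
rewrite Sy; set F := fun w => (- total_stake c (X p k ^~ w) + (vs + tau w)%:E)%E.
have mF : measurable_fun setT F.
  apply: emeasurable_funD; first exact: measurableT_comp.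
  by apply/measurable_EFinP; exact: measurable_funD.
have Fpos : (\int[P]_w F^\+ w <= D%:E)%E.
  rewrite -(integral_prob_cst P D); apply: ge0_le_integral => //.
    exact: measurable_funepos.
  move=> w _; rewrite funeposE ge_max lee_fin D0 andbT /F.
  apply: (@le_trans _ _ (vs + tau w)%:E); last first.
    by rewrite lee_fin; apply: le_trans (tauD w); exact: ler_norm.
  by rewrite geeDr// oppe_le0.
have Fneg : (\int[P]_w F^\- w = +oo)%E.
  apply/eqP; rewrite -leye_eq.
  have : (Estake P U c p k <= \int[P]_w F^\- w + D%:E)%E.
    rewrite -(integral_prob_cst P D) -ge0_integralD//; last exact: measurable_funeneg.
    apply: ge0_le_integral => //.
      by apply: emeasurable_funD => //; exact: measurable_funeneg.
    move=> w _; apply: (@le_trans _ _ (- F w + D%:E)%E); last first.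
      by apply: leeD2r; rewrite funenegE le_max lexx.
    rewrite /F oppeD ?fin_num_adde_defl// oppeK -addeA leeDl//.
    rewrite -EFinN -EFinD lee_fin addrC subr_ge0.
    by apply: le_trans (tauD w); exact: ler_norm.
  rewrite Sy; case: (\int[P]_w _)%E => //.
rewrite integralE -/F Fneg.
case: (\int[P]_w F^\+ w)%E Fpos => // r _.
Qed.

End WalkValue.

(** * Local form of the equilibrium conditions *)

Section Algebra.
Context {R : realType}.
Implicit Types (a b m n : int -> R) (i : int).

(** The four equations at a site, solved for the four adjacent increments, which depend on the two
    stakes only. The system is used in this form from here on. *)
Lemma positive_ABMN_increments a b m n i : positive_ABMN a b m n ->
  [/\ m i - m (i - 1) = a i ^+ 2 / b i, m (i + 1) - m i = 2 * a i + b i,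
      n (i - 1) - n i = a i + 2 * b i & n i - n (i + 1) = b i ^+ 2 / a i].
Proof.
move=> [/(_ i)[_ e1 e2 e3 e4] /(_ i)[a0 b0]].
have ab0 : a i + b i != 0 by rewrite lt0r_neq0// addr_gt0.
have a0' : a i != 0 by rewrite lt0r_neq0.
have b0' : b i != 0 by rewrite lt0r_neq0.
have M : m (i + 1) = m (i - 1) + (a i + b i) ^+ 2 / b i.
  by apply: (mulfI b0'); rewrite e3; field.
have N : n (i - 1) = n (i + 1) + (a i + b i) ^+ 2 / a i.
  by apply: (mulfI a0'); rewrite e4; field.
have mi : m i = m (i - 1) + a i ^+ 2 / b i.
  apply: (mulfI ab0); have -> : (a i + b i) * m i =
    (a i + b i) * (m i + a i) - (a i + b i) * a i by ring.
  by rewrite e1 M; field.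
have ni : n i = n (i + 1) + b i ^+ 2 / a i.
  apply: (mulfI ab0); have -> : (a i + b i) * n i =
    (a i + b i) * (n i + b i) - (a i + b i) * b i by ring.
  by rewrite e2 N; field.
by split; rewrite ?mi ?ni ?M ?N; field.
Qed.

Lemma increments_ABMN a b m n : (forall i, 0 < a i /\ 0 < b i) ->
  (forall i, [/\ m i - m (i - 1) = a i ^+ 2 / b i,
                 m (i + 1) - m i = 2 * a i + b i,
                 n (i - 1) - n i = a i + 2 * b i &
                 n i - n (i + 1) = b i ^+ 2 / a i]) ->
  positive_ABMN a b m n.
Proof.
move=> ab0 h; split => // i.
have [a0 b0] := ab0 i; have [e1 e2 e3 e4] := h i.
have a0' : a i != 0 by rewrite lt0r_neq0.
have b0' : b i != 0 by rewrite lt0r_neq0.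
have mp : m (i + 1) = m i + (2 * a i + b i) by rewrite -e2; ring.
have mm : m (i - 1) = m i - a i ^+ 2 / b i by rewrite -e1; ring.
have np : n (i + 1) = n i - b i ^+ 2 / a i by rewrite -e4; ring.
have nm : n (i - 1) = n i + (a i + 2 * b i) by rewrite -e3; ring.
by split; rewrite ?mp ?mm ?np ?nm; try (split; exact: ltW); field.
Qed.

Lemma positive_ABMN_mono a b m n i : positive_ABMN a b m n ->
  m i < m (i + 1) /\ n (i + 1) < n i.
Proof.
move=> h; have [_ em _ en] := positive_ABMN_increments i h.
have [a0 b0] := h.2 i.
rewrite -subr_gt0 em -(subr_gt0 (n (i + 1))) en; split; first lra.
by rewrite divr_gt0// exprn_gt0.
Qed.

(** The formula of [up_prob] at a single turn; for time-invariant stakes the two agree by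
    conversion. *)
Definition up_odds (b a : R) : R := if b + a == 0 then 2^-1 else a / (b + a).

Lemma up_odds_gt0r (b a : R) : 0 <= b -> 0 < a -> up_odds b a = a / (b + a).
Proof. by move=> b0 a0; rewrite /up_odds gt_eqF// ltr_wpDl. Qed.

Lemma up_odds_gt0l (b a : R) : 0 < b -> 0 <= a -> up_odds b a = a / (b + a).
Proof. by move=> b0 a0; rewrite /up_odds gt_eqF// ltr_pwDl. Qed.

(* Both players face the same problem: raise the probability u/(u+o) of a gain M. *)
Lemma optimal_stake (o c M : R) : 0 < o -> 0 < c ->
  (forall u, 0 <= u -> u / (u + o) * M - u <= c / (c + o) * M - c) ->
  (c + o) ^+ 2 = o * M.
Proof.
move=> o0 c0 h; apply/eqP; rewrite -subr_eq0 -oppr_eq0 opprB.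
set K := o * M - (c + o) ^+ 2.
(* The gain of [u] over [c], cleared of positive denominators. If [K] were nonzero, it would be
   positive for some [u] close to [c] on the side given by the sign of [K]. *)
have key u : 0 <= u -> (u - c) * (K - (u - c) * (c + o)) <= 0.
  move=> u0; have uo : 0 < u + o by lra.
  have co : 0 < c + o by lra.
  have e : (u - c) * (K - (u - c) * (c + o)) =
     ((u / (u + o) * M - u) - (c / (c + o) * M - c)) * ((u + o) * (c + o)).
    by rewrite /K; field; rewrite !gt_eqF.
  by rewrite e mulr_le0_ge0 ?subr_le0 ?h// mulr_ge0// ltW.
have co : 0 < c + o by lra.
have [K0|K0|//] := ltgtP K 0.
(* Half of the distance at which the second factor of [key] vanishes, capped by [c] to keep the
   stake [c - e] nonnegative. *)
- pose e := Num.min c (- K / (2 * (c + o))).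
  have e0 : 0 < e by rewrite lt_min c0/= divr_gt0//; lra.
  have ec : e <= c by rewrite ge_min lexx.
  have eK : e * (c + o) * 2 <= - K.
    have : e <= - K / (2 * (c + o)) by rewrite ge_min lexx orbT.
    by rewrite ler_pdivlMr; [lra|lra].
  have := key (c - e); rewrite subr_ge0 ec => /(_ isT).
  have -> : c - e - c = - e by ring.
  by nra.
- pose e := K / (2 * (c + o)).
  have e0 : 0 < e by rewrite divr_gt0//; lra.
  have eK : e * (c + o) * 2 = K by rewrite /e; field; rewrite gt_eqF.
  have := key (c + e); rewrite addr_ge0 ?(ltW c0) ?(ltW e0)// => /(_ isT).
  have -> : c + e - c = e by ring.
  by nra.
Qed.

Lemma small_le (u v : R) : (forall e, 0 < e -> u - e <= v) -> u <= v.
Proof.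
move=> h; rewrite leNgt; apply/negP => vu.
have := h ((u - v) / 2); rewrite divr_gt0 ?subr_gt0// => /(_ isT); lra.
Qed.

(** * Value recursions under which no deviation at one turn pays *)

Section LocalEquilibrium.
Variables a b m n : int -> R.
Hypothesis ab0 : forall i, 0 <= b i /\ 0 <= a i.
Hypothesis mE : forall i, m i = up_odds (b i) (a i) * m (i + 1)
   + (1 - up_odds (b i) (a i)) * m (i - 1) - a i.
Hypothesis nE : forall i, n i = up_odds (b i) (a i) * n (i + 1)
   + (1 - up_odds (b i) (a i)) * n (i - 1) - b i.
Hypothesis mB : forall i u, 0 <= u -> up_odds (b i) u * m (i + 1)
   + (1 - up_odds (b i) u) * m (i - 1) - u <= m i.
Hypothesis nB : forall i u, 0 <= u -> up_odds u (a i) * n (i + 1)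
   + (1 - up_odds u (a i)) * n (i - 1) - u <= n i.

(** A player staking alone wins the turn with certainty whatever the positive amount, so halving the
    stake would pay. *)
Lemma stakes_vanish_together i : (a i = 0 /\ b i = 0) \/ (0 < a i /\ 0 < b i).
Proof.
have [b0 a0] := ab0 i; move: b0 a0; rewrite !le_eqVlt.
move=> /orP[/eqP b0|b0] /orP[/eqP a0|a0]; [by left| | |by right].
- have := mB i (u := a i / 2); rewrite (mE i) -b0 !up_odds_gt0r//; try lra.
  have -> : a i / (0 + a i) = 1 by rewrite add0r divff// gt_eqF.
  have -> : a i / 2 / (0 + a i / 2) = 1 by rewrite add0r divff// gt_eqF//; lra.
  lra.
- have := nB i (u := b i / 2); rewrite (nE i) -a0 !up_odds_gt0l//; try lra.
Qed.

Lemma positive_site i : 0 < a i -> 0 < b i ->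
  (a i + b i) ^+ 2 = b i * (m (i + 1) - m (i - 1)) /\
  (a i + b i) ^+ 2 = a i * (n (i - 1) - n (i + 1)).
Proof.
move=> a0 b0; split.
  apply: optimal_stake => // u u0; have := mB i u0; rewrite (mE i).
  rewrite (up_odds_gt0l b0 u0) (up_odds_gt0l b0 (ltW a0)) ![b i + _]addrC; lra.
rewrite addrC; apply: optimal_stake => // u u0; have := nB i u0; rewrite (nE i).
rewrite (up_odds_gt0r u0 a0) (up_odds_gt0r (ltW b0) a0).
have e v : 0 <= v -> a i / (v + a i) = 1 - v / (v + a i).
  by move=> v0; field; rewrite gt_eqF//; lra.
rewrite (e _ u0) (e _ (ltW b0)); lra.
Qed.

Lemma positive_site_mono i : 0 < a i -> 0 < b i ->
  m (i - 1) < m i /\ m i < m (i + 1).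
Proof.
move=> a0 b0; have [e _] := positive_site a0 b0.
have ab : 0 < b i + a i by lra.
have mp : m (i + 1) = m (i - 1) + (a i + b i) ^+ 2 / b i.
  by rewrite e; field; rewrite gt_eqF.
have mi : m i = m (i - 1) + a i ^+ 2 / b i.
  by rewrite (mE i) up_odds_gt0l ?ltW// mp; field; rewrite !gt_eqF.
have q : 0 < a i ^+ 2 / b i by rewrite divr_gt0// exprn_gt0.
split; first by rewrite mi ltrDl.
have -> : m (i + 1) = m i + (2 * a i + b i).
  by rewrite mp mi; field; rewrite gt_eqF.
by rewrite ltrDl; lra.
Qed.

(** Against no stake an arbitrarily small one buys a certain up step, which gives the first
    inequality. The second follows because [m i] is then the average of its neighbours. *)
Lemma zero_site i : a i = 0 -> b i = 0 -> m (i + 1) <= m i /\ m i <= m (i - 1).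
Proof.
move=> a0 b0.
have e0 : up_odds (b i) (a i) = 2^-1 by rewrite /up_odds a0 b0 addr0 eqxx.
have le1 : m (i + 1) <= m i.
  apply: small_le => e e0'; have := mB i (ltW e0').
  by rewrite b0 up_odds_gt0r// add0r divff ?gt_eqF//; lra.
by split => //; have := mE i; rewrite e0 a0; lra.
Qed.

(** Around a site without stakes [m] does not increase, around a positive site it increases
    strictly; adjacent sites share an increment. *)
Lemma zero_neighbours i : a i = 0 /\ b i = 0 ->
  (a (i + 1) = 0 /\ b (i + 1) = 0) /\ (a (i - 1) = 0 /\ b (i - 1) = 0).
Proof.
move=> [a0 b0]; have [h1 h2] := zero_site a0 b0; split.
  have [//|[ap bp]] := stakes_vanish_together (i + 1).
  have [] := positive_site_mono ap bp; rewrite addrK; lra.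
have [//|[ap bp]] := stakes_vanish_together (i - 1).
have [] := positive_site_mono ap bp; rewrite subrK; lra.
Qed.

Lemma zero_everywhere i j : a i = 0 /\ b i = 0 -> a j = 0 /\ b j = 0.
Proof.
move=> h.
have up (k : nat) : a (i + k%:Z) = 0 /\ b (i + k%:Z) = 0.
  elim: k => [|k IH]; first by rewrite addr0.
  have [+ _] := zero_neighbours IH.
  by have -> : i + k%:Z + 1 = i + k.+1%:Z by lia.
have dn (k : nat) : a (i - k%:Z) = 0 /\ b (i - k%:Z) = 0.
  elim: k => [|k IH]; first by rewrite subr0.
  have [_] := zero_neighbours IH.
  by have -> : i - k%:Z - 1 = i - k.+1%:Z by lia.
have [ij|ij] := lerP i j.
  by have := up `|j - i|%N; have -> : i + `|j - i|%N%:Z = j by lia.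
by have := dn `|j - i|%N; have -> : i - `|j - i|%N%:Z = j by lia.
Qed.

Lemma local_equilibrium_ABMN :
  (forall i, a i = 0 /\ b i = 0) \/ positive_ABMN a b m n.
Proof.
have [h|h] := pselect (forall i, 0 < a i /\ 0 < b i); last first.
  left; move=> j; move/existsNP: h => [i hi]; apply: (@zero_everywhere i).
  by have [] := stakes_vanish_together i.
right; split => // i; have [a0 b0] := h i; have [e1 e2] := positive_site a0 b0.
have ab : 0 < b i + a i by lra.
split => //; first by split; exact: ltW.
- by rewrite (mE i) up_odds_gt0l ?ltW//; field; rewrite gt_eqF.
- by rewrite (nE i) up_odds_gt0l ?ltW//; field; rewrite gt_eqF.
Qed.

End LocalEquilibrium.

(** The loss from staking [u] in place of [a i] is the square [(a i - u) ^+ 2] over [b i + u]. *)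
Lemma ABMN_best_reply_maxine a b m n i (u : R) : positive_ABMN a b m n -> 0 <= u ->
  up_odds (b i) u * m (i + 1) + (1 - up_odds (b i) u) * m (i - 1) <= m i + u.
Proof.
move=> h u0; have [a0 b0] := h.2 i.
have [e1 e2 _ _] := positive_ABMN_increments i h.
have mp : m (i + 1) = m i + (2 * a i + b i) by rewrite -e2; ring.
have mm : m (i - 1) = m i - a i ^+ 2 / b i by rewrite -e1; ring.
rewrite up_odds_gt0l// mp mm -subr_ge0.
have bu : 0 < b i + u by lra.
have -> : m i + u - (u / (b i + u) * (m i + (2 * a i + b i)) +
     (1 - u / (b i + u)) * (m i - a i ^+ 2 / b i)) =
   (a i - u) ^+ 2 / (b i + u) by field; rewrite !gt_eqF.
by rewrite divr_ge0 ?sqr_ge0// ltW.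
Qed.

Lemma ABMN_best_reply_mina a b m n i (u : R) : positive_ABMN a b m n -> 0 <= u ->
  up_odds u (a i) * n (i + 1) + (1 - up_odds u (a i)) * n (i - 1) <= n i + u.
Proof.
move=> h u0; have [a0 b0] := h.2 i.
have [_ _ e1 e2] := positive_ABMN_increments i h.
have np : n (i + 1) = n i - b i ^+ 2 / a i by rewrite -e2; ring.
have nm : n (i - 1) = n i + (a i + 2 * b i) by rewrite -e1; ring.
rewrite up_odds_gt0r// np nm -subr_ge0.
have bu : 0 < u + a i by lra.
have -> : n i + u - (a i / (u + a i) * (n i - b i ^+ 2 / a i) +
     (1 - a i / (u + a i)) * (n i + (a i + 2 * b i))) =
   (b i - u) ^+ 2 / (u + a i) by field; rewrite !gt_eqF.
by rewrite divr_ge0 ?sqr_ge0// ltW.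
Qed.

Lemma ABMN_value_maxine a b m n i : positive_ABMN a b m n ->
  up_odds (b i) (a i) * m (i + 1) + (1 - up_odds (b i) (a i)) * m (i - 1) =
  m i + a i.
Proof.
move=> h; have [a0 b0] := h.2 i; have [_ e1 _ _ _] := h.1 i.
have ab : b i + a i != 0 by rewrite gt_eqF//; lra.
apply: (mulfI ab); rewrite up_odds_gt0l ?ltW// [in RHS](addrC (b i)) e1.
by field.
Qed.

Lemma ABMN_value_mina a b m n i : positive_ABMN a b m n ->
  up_odds (b i) (a i) * n (i + 1) + (1 - up_odds (b i) (a i)) * n (i - 1) =
  n i + b i.
Proof.
move=> h; have [a0 b0] := h.2 i; have [_ _ e1 _ _] := h.1 i.
have ab : b i + a i != 0 by rewrite gt_eqF//; lra.
apply: (mulfI ab); rewrite up_odds_gt0l ?ltW// [in RHS](addrC (b i)) e1.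
by field.
Qed.

(** * Monotone functions on the integers and their limits at both ends *)

Lemma mono_int (f : int -> R) : (forall i, f i <= f (i + 1)) ->
  forall i j, i <= j -> f i <= f j.
Proof.
move=> h i j ij; have -> : j = i + `|j - i|%N%:Z by lia.
elim: `|j - i|%N => [|k IH]; first by rewrite addr0.
by apply: le_trans IH _; have -> : i + k.+1%:Z = i + k%:Z + 1 by lia.
Qed.

Lemma mono_lim_pinfty (f : int -> R) l : (forall i, f i <= f (i + 1)) ->
  lim_pinfty f l -> forall i, f i <= l.
Proof.
move=> /mono_int h fl i; rewrite -(cvg_lim _ fl)//; apply: limr_ge.
  by apply/cvg_ex; exists l.
by exists `|i|%N => // k /= ik; apply: h; lia.
Qed.

Lemma mono_lim_ninfty (f : int -> R) l : (forall i, f i <= f (i + 1)) ->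
  lim_ninfty f l -> forall i, l <= f i.
Proof.
move=> /mono_int h fl i; rewrite -(cvg_lim _ fl)//; apply: limr_le.
  by apply/cvg_ex; exists l.
by exists `|i|%N => // k /= ik; apply: h; lia.
Qed.

Lemma mono_bounded_cvg (f : int -> R) (l u : R) : (forall i, f i <= f (i + 1)) ->
  (forall i, l <= f i <= u) ->
  (exists lo, lim_ninfty f lo) /\ (exists hi, lim_pinfty f hi).
Proof.
move=> /mono_int h fb; split.
  apply/cvg_ex; apply: nonincreasing_is_cvgn.
    by move=> j k jk; apply: h; lia.
  by exists l => _ [k _ <-]; have /andP[] := fb (- k%:Z).
apply/cvg_ex; apply: nondecreasing_is_cvgn.
  by move=> j k jk; apply: h; lia.
by exists u => _ [k _ <-]; have /andP[] := fb k%:Z.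
Qed.

Lemma lim_ninftyN (f : int -> R) l :
  lim_ninfty f l -> lim_ninfty (fun i => - f i) (- l).
Proof. exact: cvgN. Qed.

Lemma lim_pinftyN (f : int -> R) l :
  lim_pinfty f l -> lim_pinfty (fun i => - f i) (- l).
Proof. exact: cvgN. Qed.

End Algebra.

(** * Values of the game *)

Section Nash.
Context {R : realType} {d : measure_display} {T : measurableType d}.
Variables (P : probability T R) (U : nat -> T -> R).
Hypothesis hU : iid_uniform P U.
Implicit Types (p c : int -> nat -> R) (k : int).

Local Notation Pd := (Pdown P U).
Local Notation Pu := (Pup P U).
Local Notation E := (Estake P U).

Lemma walkE Sm Sp k t w : walk Sm Sp U k t w = gwalk U (up_prob Sm Sp) k t w.
Proof. by elim: t => //= t ->. Qed.

Lemma transition_up_prob (Sm Sp : int -> nat -> R) :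
  strategy Sm -> strategy Sp -> transition (up_prob Sm Sp).
Proof.
move=> hm hp i t; rewrite /up_prob; have := hm i t; have := hp i t.
case: eqP => [_ _ _|/eqP s0 p0 m0]; first by apply/andP; split; lra.
have s1 : 0 < Sm i t + Sp i t by rewrite lt0r s0 addr_ge0.
by rewrite divr_ge0 ?(ltW s1)//= ler_pdivrMr// mul1r lerDr.
Qed.

Definition expected_terminal (vd vu vs : R) p k : R :=
  vd * Pd p k + vu * Pu p k + vs * (1 - Pd p k - Pu p k).

Definition value (vd vu vs : R) c p k : \bar R :=
  ((expected_terminal vd vu vs p k)%:E - E c p k)%E.

(** Real version of [value], faithful only for a finite expected stake, as [fine] sends [+oo] to
    0. *)
Definition rvalue (vd vu vs : R) c p k : R :=
  expected_terminal vd vu vs p k - fine (E c p k).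

Lemma payoff_minaE vd vu vs Sm Sp k : strategy Sm ->
  (\int[P]_w payoff_mina vd vu vs Sm Sp U k w)%E =
  value vd vu vs Sm (up_prob Sm Sp) k.
Proof.
move=> hm; rewrite /value /expected_terminal -integral_payoff//.
apply: eq_integral => w _; rewrite /payoff_mina.
by under [walk _ _ _ _ ^~ w]funext do rewrite walkE.
Qed.

Lemma payoff_maxineE vd vu vs Sm Sp k : strategy Sp ->
  (\int[P]_w payoff_maxine vd vu vs Sm Sp U k w)%E =
  value vd vu vs Sp (up_prob Sm Sp) k.
Proof.
move=> hm; rewrite /value /expected_terminal -integral_payoff//.
apply: eq_integral => w _; rewrite /payoff_maxine.
by under [walk _ _ _ _ ^~ w]funext do rewrite walkE.
Qed.

Lemma valueE vd vu vs c p k : E c p k \is a fin_num ->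
  value vd vu vs c p k = (rvalue vd vu vs c p k)%:E.
Proof. by move=> f; rewrite /rvalue EFinB fineK. Qed.

Lemma expected_terminal_bound vd vu vs p k :
  `|expected_terminal vd vu vs p k| <= `|vd| + `|vu| + `|vs|.
Proof.
have pd := Pdown_ge0 P U p k; have pu := Pup_ge0 P U p k.
have pdu := Pdown_Pup_le1 hU p k.
rewrite /expected_terminal; apply: le_trans (ler_normD _ _) _.
apply: lerD; first apply: le_trans (ler_normD _ _) _; first apply: lerD.
- by rewrite normrM ler_piMr// ger0_norm//; lra.
- by rewrite normrM ler_piMr// ger0_norm//; lra.
- by rewrite normrM ler_piMr// ger0_norm//; lra.
Qed.

(** The primed play may differ from the unprimed one at the first turn only. Taking both equal and
    constant in time gives the recursion for the values; otherwise it prices a deviation at one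
    turn. *)
Lemma value_first_turn vd vu vs c c' p p' k :
  transition p' -> strategy c' -> shift_time p' = p -> shift_time c' = c ->
  (forall j, E c p j \is a fin_num) ->
  value vd vu vs c' p' k =
  (p' k 0%N * rvalue vd vu vs c p (k + 1)
   + (1 - p' k 0%N) * rvalue vd vu vs c p (k - 1) - c' k 0%N)%:E.
Proof.
move=> hp hc ep ec fin; rewrite /value /expected_terminal.
rewrite (Pdown_step hU k hp) (Pup_step hU k hp) (Estake_step hU k hp hc) ep ec.
rewrite -(fineK (fin (k + 1))) -(fineK (fin (k - 1))).
rewrite -!EFinM -!EFinD; congr (_%:E).
by rewrite /rvalue /expected_terminal; ring.
Qed.

Lemma Estake_zero p k : E (fun _ _ => 0) p k = 0%E.
Proof.
rewrite /Estake; under eq_integral do rewrite /total_stake eseries0//.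
by rewrite integral0.
Qed.

(** [terminal_bound] caps the payoff of every deviation by the deviator's value at [k], and
    [terminal_exact] shows that the given pair attains it. Since [mst] and [nst] are nonpositive,
    paths that do not escape bring no extra gain. *)
Lemma standard_Nash (a b m n : int -> R) (x mst nst : R) :
  standard_ABMN a b m n -> lim_ninfty n x -> mst <= 0 -> nst <= 0 ->
  Nash_equilibrium P U 0 1 x 0 mst nst (ti_mina b) (ti_maxine a).
Proof.
move=> [h m0 n0 m1] nx hm hn k.
have a0 i : 0 < a i by have [] := h.2 i.
have b0 i : 0 < b i by have [] := h.2 i.
have sa : strategy (ti_maxine a) by move=> i t; rewrite /ti_maxine ltW.
have sb : strategy (ti_mina b) by move=> i t; rewrite /ti_mina ltW.
have mmono i : m i <= m (i + 1) by have [/ltW] := positive_ABMN_mono i h.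
have nmono i : - n i <= - n (i + 1).
  by rewrite lerN2; have [_ /ltW] := positive_ABMN_mono i h.
have mge := mono_lim_ninfty mmono m0.
have mle := mono_lim_pinfty mmono m1.
have nle i : n i <= x.
  by have := mono_lim_ninfty nmono (lim_ninftyN nx) i; rewrite lerN2.
have nge i : 0 <= n i.
  by have := mono_lim_pinfty nmono (lim_pinftyN n0) i; rewrite lerN2.
have hp := transition_up_prob sb sa.
split => S' hS'.
  rewrite !payoff_minaE//.
  have hp' := transition_up_prob hS' sa.
  set p' := up_prob S' _ in hp' *.
  have := terminal_bound hU k hp' hS' nge nx n0
     (fun i t => ABMN_best_reply_mina i h (hS' i t)).
  have nb i : 0 <= n i <= x by rewrite nge nle.
  have [AB1 eqE] := terminal_exact hU k hp b0 nb nx n0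
     (fun i t => ABMN_value_mina i h).
  rewrite /value eqE /expected_terminal.
  have pd := Pdown_Pup_le1 hU p' k.
  have neg : nst * (1 - Pd p' k - Pu p' k) <= 0.
    by apply: mulr_le0_ge0 => //; lra.
  case: (E S' p' k) => [r| |]//=; last by rewrite leNye.
  rewrite -!EFinD !lee_fin => le1.
  have -> : 1 - Pd (up_prob (ti_mina b) (ti_maxine a)) k
     - Pu (up_prob (ti_mina b) (ti_maxine a)) k = 0 by lra.
  lra.
rewrite !payoff_maxineE//.
have hp' := transition_up_prob sb hS'.
set p' := up_prob _ S' in hp' *.
have := terminal_bound hU k hp' hS' mge m0 m1
   (fun i t => ABMN_best_reply_maxine i h (hS' i t)).
have mb i : 0 <= m i <= 1 by rewrite mge mle.
have [AB1 eqE] := terminal_exact hU k hp a0 mb m0 m1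
   (fun i t => ABMN_value_maxine i h).
rewrite /value eqE /expected_terminal.
have pd := Pdown_Pup_le1 hU p' k.
have neg : mst * (1 - Pd p' k - Pu p' k) <= 0.
  by apply: mulr_le0_ge0 => //; lra.
case: (E S' p' k) => [r| |]//=; last by rewrite leNye.
rewrite -!EFinD !lee_fin => le1.
have -> : 1 - Pd (up_prob (ti_mina b) (ti_maxine a)) k
   - Pu (up_prob (ti_mina b) (ti_maxine a)) k = 0 by lra.
lra.
Qed.

(** At each time the walk is positive with probability at most one half, by reflection; Fatou's
    lemma for the indicator of the positive sites passes to the limit. *)
Lemma fair_walk_Pup : Pu (fun _ _ => 2^-1) 0 <= 2^-1.
Proof.
pose p : int -> nat -> R := fun _ _ => 2^-1.
have hp : transition p by move=> i t; apply/andP; split; rewrite /p; lra.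
pose g (i : int) : R := if 0 < i then 1 else 0.
have g0 i : 0 <= g i by rewrite /g; case: ifP.
have g1 i : g i <= 1 by rewrite /g; case: ifP.
pose u t i := fine (Eat P U p i t g).
have uE t i : Eat P U p i t g = (u t i)%:E.
  rewrite fineK// ge0_fin_numE ?Eat_ge0//.
  apply: (@le_lt_trans _ _ 1%E); last exact: ltry.
  by rewrite -(Eat_cst P U p i t 1); exact: Eat_le.
have uS t i : u t.+1 i = 2^-1 * u t (i + 1) + (1 - 2^-1) * u t (i - 1).
  by apply: EFin_inj; rewrite -uE Eat_step// !uE -!EFinM -EFinD.
(* The walk is invariant under reflection at the origin. *)
have sym t i : u t i + u t (- i) <= 1.
  elim: t i => [|t IH] i.
    rewrite /u !Eat0 /= /g oppr_gt0.
    by have [i0|i0|_] := ltgtP 0 i; rewrite ?addr0 ?add0r.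
  rewrite !uS; have := IH (i + 1); have := IH (i - 1).
  have -> : - (i - 1) = - i + 1 by ring.
  have -> : - (i + 1) = - i - 1 by ring.
  lra.
have := @Eat_fatou _ _ _ P U hU p 0 g 0 1 2^-1 0 g0.
rewrite mul0r add0r mul1r; apply.
- apply: cvg_near_cst; exists 0%N => // t _ /=; rewrite /g; case: ltP => //; lia.
- by apply: cvg_near_cst; exists 1%N => // t /= t1; rewrite /g; case: ltP => //; lia.
- by move=> t _; rewrite uE lee_fin; have := sym t 0; rewrite oppr0; lra.
Qed.

(** Outside the null event that some [U t] is at least 1, every step goes up. *)
Lemma certain_walk_Pup k : Pu (fun _ _ => 1) k = 1.
Proof.
apply: EFin_inj; rewrite -PupE//; apply: probability_full.
  exact: (measurable_event_up hU).
have [_ hc _] := hU.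
have neg t : P.-negligible (~` (U t @^-1` `]-oo, 1[%classic)).
  have mt : measurable (U t @^-1` `]-oo, 1[%classic).
    exact: (measurable_U hU t (measurable_itv _)).
  apply/negligibleP; first exact: measurableC.
  apply: etrans (probability_setC P mt) _.
  by rewrite hc ?ler01 ?lexx// subee.
apply: negligibleS (negligible_bigcup neg) => w /= nw.
apply: contrapT => hw; apply: nw.
have step1 t : U t w < 1.
  have [//|h] := ltP (U t w) 1; exfalso; apply: hw; exists t => //.
  by rewrite /= in_itv/= ltNge h.
have wt t : gwalk U (fun _ _ => 1) k t w = k + t%:Z.
  by elim: t => [|t IH] /=; [rewrite addr0|rewrite IH step1; lia].
by move=> M; exists `|M - k|%N => t; rewrite wt; lia.
Qed.

Lemma zero_not_Nash (x mst nst : R) : mst <= 0 ->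
  ~ Nash_equilibrium P U 0 1 x 0 mst nst (ti_mina (fun=> 0)) (ti_maxine (fun=> 0)).
Proof.
move=> hm /(_ 0)[_ h].
(* Positive stakes of total 1/4 win every turn against none: Maxine's payoff rises from at most 1/2
   to at least 3/4. *)
pose S' : int -> nat -> R := fun _ t => 2^-1 ^+ t.+3.
have hS' : strategy S' by move=> i t; rewrite exprn_ge0//; lra.
have := h S' hS'; rewrite !payoff_maxineE//.
have -> : up_prob (ti_mina (fun=> 0)) (ti_maxine (fun=> 0)) =
    (fun _ _ => 2^-1) :> (int -> nat -> R).
  apply/funext => i; apply/funext => t.
  by rewrite /up_prob /ti_mina /ti_maxine addr0 eqxx.
have -> : up_prob (ti_mina (fun=> 0)) S' = (fun _ _ => 1).
  apply/funext => i; apply/funext => t.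
  have S0 : S' i t != 0 by rewrite expf_neq0//; lra.
  by rewrite /up_prob /ti_mina add0r (negbTE S0) divff.
have E4 : (E S' (fun _ _ => 1%R) 0%R <= (4^-1)%:E)%E.
  rewrite -(integral_prob_cst P 4^-1); apply: ge0_le_integral => //.
  - by move=> w _; exact: total_stake_ge0.
  - exact: (measurable_stake hU _ _ hS').
  move=> w _; apply: lime_le; first by apply: is_cvg_nneseries => t _ _; rewrite lee_fin.
  apply: nearW => t; rewrite sumEFin lee_fin.
  suff -> : \sum_(0 <= i < t) 2^-1 ^+ i.+3 = 4^-1 - 2^-1 ^+ t.+2 :> R.
    by rewrite gerBl exprn_ge0//; lra.
  elim: t => [|t IH]; first by rewrite big_nil !exprS expr0; lra.
  by rewrite big_nat_recr//= IH !exprS; lra.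
rewrite /value Estake_zero sube0 /expected_terminal certain_walk_Pup.
have := Pdown_Pup_le1 hU (fun _ _ => 1) 0; rewrite certain_walk_Pup.
have := Pdown_ge0 P U (fun _ _ => 1) 0 => pd0 pd1.
have -> : Pd (fun _ _ => 1) 0 = 0 by lra.
have := fair_walk_Pup; have := Pdown_Pup_le1 hU (fun _ _ => 2^-1) 0.
set al := Pd _ _; set be := Pu _ _ => ab1 be2.
have neg : mst * (1 - al - be) <= 0 by apply: mulr_le0_ge0 => //; lra.
have := Estake_ge0 P U (fun _ _ => 1) 0 hS'.
case: (E S' _ _) E4 => [r| |]//=; rewrite !lee_fin => r4 _; lra.
Qed.

End Nash.

(** * From equilibria to standard solutions *)

Section NashConverse.
Context {R : realType} {d : measure_display} {T : measurableType d}.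
Variables (P : probability T R) (U : nat -> T -> R).
Hypothesis hU : iid_uniform P U.

(** Used with [q] an escape probability that tends to 0 or 1, to extract from one identity a linear
    equation between boundary values at each end. *)
Lemma lim_affine_cst (q : int -> R) (f : nat -> int) (l r s : R) :
  q (f k) @[k --> \oo] --> l -> (forall k, q k * r = s) -> l * r = s.
Proof.
move=> ql qs; have : q (f k) * r @[k --> \oo] --> l * r.
  by apply: cvgM => //; exact: cvg_cst.
under eq_fun do rewrite qs.
by move=> /(cvg_unique _ (cvg_cst s)) ->.
Qed.

Lemma Nash_standard (a b : int -> R) (x mst nst : R) :
  (forall i, 0 <= b i /\ 0 <= a i) -> mst <= 0 ->
  Nash_equilibrium P U 0 1 x 0 mst nst (ti_mina b) (ti_maxine a) ->
  exists m n, standard_ABMN a b m n /\ lim_ninfty n x.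
Proof.
move=> ab0 hm NE.
have sa : strategy (ti_maxine a) by move=> i t; have [] := ab0 i.
have sb : strategy (ti_mina b) by move=> i t; have [] := ab0 i.
pose p := up_prob (ti_mina b) (ti_maxine a).
have hp : transition p by exact: transition_up_prob.
pose zero : int -> nat -> R := fun _ _ => 0.
have s0 : strategy zero by move=> i t.
have NEb S' k : strategy S' ->
    (value P U x 0 nst S' (up_prob S' (ti_maxine a)) k <=
     value P U x 0 nst (ti_mina b) p k)%E.
  by move=> hS; have [/(_ _ hS)] := NE k; rewrite !payoff_minaE.
have NEa S' k : strategy S' ->
    (value P U 0 1 mst S' (up_prob (ti_mina b) S') k <=
     value P U 0 1 mst (ti_maxine a) p k)%E.
  by move=> hS; have [_ /(_ _ hS)] := NE k; rewrite !payoff_maxineE.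
have value0 vd vu vs q k : value P U vd vu vs zero q k =
    (expected_terminal P U vd vu vs q k)%:E.
  by rewrite /value Estake_zero sube0.
(* Staking nothing secures a real payoff, so at equilibrium neither expected stake can be
   infinite. *)
have fin vd vu vs c k (r : R) : strategy c ->
    (r%:E <= value P U vd vu vs c p k)%E -> Estake P U c p k \is a fin_num.
  move=> sc; rewrite ge0_fin_numE ?Estake_ge0// /value.
  by case: (Estake P U c p k) => // s _; rewrite ltry.
have fa k : Estake P U (ti_maxine a) p k \is a fin_num.
  by have := NEa zero k s0; rewrite value0; exact: fin.
have fb k : Estake P U (ti_mina b) p k \is a fin_num.
  by have := NEb zero k s0; rewrite value0; exact: fin.
pose m k := rvalue P U 0 1 mst (ti_maxine a) p k.
pose n k := rvalue P U x 0 nst (ti_mina b) p k.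
have bound vd vu vs q k := expected_terminal_bound hU vd vu vs q k.
have ea0 k : 0 <= fine (Estake P U (ti_maxine a) p k) by rewrite fine_ge0// Estake_ge0.
have eb0 k : 0 <= fine (Estake P U (ti_mina b) p k) by rewrite fine_ge0// Estake_ge0.
pose Dm := `|0 : R| + `|1 : R| + `|mst|; pose Dn := `|x| + `|0 : R| + `|nst|.
have mb k : - Dm <= m k <= Dm.
  have := NEa zero k s0; rewrite value0 valueE// lee_fin -/(m k) => le1.
  have := bound 0 1 mst (up_prob (ti_mina b) zero) k; rewrite ler_norml => /andP[? _].
  have := bound 0 1 mst p k; rewrite ler_norml => /andP[_ ?].
  by rewrite /Dm; apply/andP; split; [lra|rewrite /m /rvalue; have := ea0 k; lra].
have nb k : - Dn <= n k <= Dn.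
  have := NEb zero k s0; rewrite value0 valueE// lee_fin -/(n k) => le1.
  have := bound x 0 nst (up_prob zero (ti_maxine a)) k; rewrite ler_norml => /andP[? _].
  have := bound x 0 nst p k; rewrite ler_norml => /andP[_ ?].
  by rewrite /Dn; apply/andP; split; [lra|rewrite /n /rvalue; have := eb0 k; lra].
have mE i : m i = up_odds (b i) (a i) * m (i + 1)
   + (1 - up_odds (b i) (a i)) * m (i - 1) - a i.
  apply: EFin_inj; rewrite -valueE//.
  exact: (value_first_turn hU 0 1 mst i hp sa (erefl : shift_time p = p)
    (erefl : shift_time (ti_maxine a) = ti_maxine a) fa).
have nE i : n i = up_odds (b i) (a i) * n (i + 1)
   + (1 - up_odds (b i) (a i)) * n (i - 1) - b i.
  apply: EFin_inj; rewrite -valueE//.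
  exact: (value_first_turn hU x 0 nst i hp sb (erefl : shift_time p = p)
    (erefl : shift_time (ti_mina b) = ti_mina b) fb).
have mB i u : 0 <= u -> up_odds (b i) u * m (i + 1)
   + (1 - up_odds (b i) u) * m (i - 1) - u <= m i.
  (* Deviation at the first turn only; after a time shift the play is the equilibrium again, by
     conversion. *)
  move=> u0; pose S' : int -> nat -> R := fun j t => if t is 0%N then u else a j.
  have hS' : strategy S' by move=> j [|t] //=; have [] := ab0 j.
  have := NEa S' i hS'.
  have hp' := transition_up_prob sb hS'.
  rewrite (value_first_turn hU 0 1 mst i hp' hS'
    (erefl : shift_time (up_prob (ti_mina b) S') = p)
    (erefl : shift_time S' = ti_maxine a) fa) valueE// lee_fin.
have nB i u : 0 <= u -> up_odds u (a i) * n (i + 1)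
   + (1 - up_odds u (a i)) * n (i - 1) - u <= n i.
  move=> u0; pose S' : int -> nat -> R := fun j t => if t is 0%N then u else b j.
  have hS' : strategy S' by move=> j [|t] //=; have [] := ab0 j.
  have := NEb S' i hS'.
  have hp' := transition_up_prob hS' sa.
  rewrite (value_first_turn hU x 0 nst i hp' hS'
    (erefl : shift_time (up_prob S' (ti_maxine a)) = p)
    (erefl : shift_time S' = ti_mina b) fb) valueE// lee_fin.
have [z|pos] := local_equilibrium_ABMN ab0 mE nE mB nB.
  exfalso; apply: (zero_not_Nash hU hm (x := x) (nst := nst)).
  have ea : a = fun=> 0 by apply/funext => i; have [] := z i.
  have eb : b = fun=> 0 by apply/funext => i; have [] := z i.
  by move: NE; rewrite eb ea.
have ap i : 0 < a i by have [] := pos.2 i.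
have bp i : 0 < b i by have [] := pos.2 i.
have mmono i : m i <= m (i + 1) by have [/ltW] := positive_ABMN_mono i pos.
have nmono i : - n i <= - n (i + 1).
  by rewrite lerN2; have [_ /ltW] := positive_ABMN_mono i pos.
have [[ml mlP] [mh mhP]] := mono_bounded_cvg mmono mb.
have [[nl' nlP] [nh' nhP]] : (exists lo, lim_ninfty (fun i => - n i) lo) /\
    (exists hi, lim_pinfty (fun i => - n i) hi).
  apply: (mono_bounded_cvg (l := - Dn) (u := Dn) nmono) => i.
  by have := nb i; lra.
pose nl := - nl'; pose nh := - nh'.
have {nlP} nlP : lim_ninfty n nl.
  by have := lim_ninftyN nlP; under eq_fun do rewrite opprK.
have {nhP} nhP : lim_pinfty n nh.
  by have := lim_pinftyN nhP; under eq_fun do rewrite opprK.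
have mge := mono_lim_ninfty mmono mlP.
have mle := mono_lim_pinfty mmono mhP.
have nle i : n i <= nl.
  by have := mono_lim_ninfty nmono (lim_ninftyN nlP) i; rewrite lerN2.
have nge i : nh <= n i.
  by have := mono_lim_pinfty nmono (lim_pinftyN nhP) i; rewrite lerN2.
have mlh : ml < mh.
  have [lt0 _] := positive_ABMN_mono 0 pos.
  by apply: le_lt_trans (mge 0) _; apply: lt_le_trans lt0 (mle _).
have nlh : nh < nl.
  have [_ lt0] := positive_ABMN_mono 0 pos.
  by apply: le_lt_trans (nge _) _; apply: lt_le_trans lt0 (nle 0).
pose al := Pdown P U p; pose be := Pup P U p.
(* Two expressions for Maxine's expected stake are compared, one from [m k] as her payoff and one
   from optional stopping of [m - ml]. The last inequality says that this stake is nonnegative. *)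
have keym k : [/\ al k + be k = 1, be k * (1 - mh + ml) = ml &
    (mh - ml) * be k >= m k - ml].
  have gb i : 0 <= m i - ml <= mh - ml by rewrite subr_ge0 mge lerD2r mle.
  have gd : lim_ninfty (fun i => m i - ml) (ml - ml).
    by apply: cvgB => //; exact: cvg_cst.
  have gu : lim_pinfty (fun i => m i - ml) (mh - ml).
    by apply: cvgB => //; exact: cvg_cst.
  have ge i (t : nat) : p i t * (m (i + 1) - ml) + (1 - p i t) * (m (i - 1) - ml) =
      m i - ml + a i.
    have e : p i t * m (i + 1) + (1 - p i t) * m (i - 1) = m i + a i.
      exact: (ABMN_value_maxine i pos).
    lra.
  have [AB1 eqE] := terminal_exact hU k hp ap gb gd gu ge.
  have e0 := ea0 k.
  have mk : m k = expected_terminal P U 0 1 mst p k - fine (Estake P U (ti_maxine a) p k).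
    by [].
  move: e0 mk; rewrite eqE /= /expected_terminal -/(al k) -/(be k).
  have -> : 1 - al k - be k = 0 by rewrite /al /be; lra.
  by move=> e0 mk; split; [exact: AB1|lra|lra].
have keyn k : al k * (x - nl + nh) = nh /\ (nl - nh) * al k >= n k - nh.
  have gb i : 0 <= n i - nh <= nl - nh by rewrite subr_ge0 nge lerD2r nle.
  have gd : lim_ninfty (fun i => n i - nh) (nl - nh).
    by apply: cvgB => //; exact: cvg_cst.
  have gu : lim_pinfty (fun i => n i - nh) (nh - nh).
    by apply: cvgB => //; exact: cvg_cst.
  have ge i (t : nat) : p i t * (n (i + 1) - nh) + (1 - p i t) * (n (i - 1) - nh) =
      n i - nh + b i.
    have e : p i t * n (i + 1) + (1 - p i t) * n (i - 1) = n i + b i.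
      exact: (ABMN_value_mina i pos).
    lra.
  have [AB1 eqE] := terminal_exact hU k hp bp gb gd gu ge.
  have e0 := eb0 k.
  have nk : n k = expected_terminal P U x 0 nst p k - fine (Estake P U (ti_mina b) p k).
    by [].
  move: e0 nk; rewrite eqE /= /expected_terminal -/(al k) -/(be k).
  have -> : 1 - al k - be k = 0 by rewrite /al /be; lra.
  by move=> e0 nk; split; lra.
have be_le1 k : be k <= 1.
  by have [<- _ _] := keym k; rewrite lerDr Pdown_ge0.
have al_le1 k : al k <= 1.
  by have [<- _ _] := keym k; rewrite lerDl Pup_ge0.
(* Starting far to the right, Maxine's value nears its supremum, which is only
   possible if the walk escapes to the right with probability nearing one. *)
have be1 : be k%:Z @[k --> \oo] --> (1 : R).
  apply: (@squeeze_cvgr _ _ _ _ (fun k : nat => (m k%:Z - ml) / (mh - ml)) (fun=> 1)).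
  - apply: nearW => k; rewrite be_le1 andbT ler_pdivrMr ?subr_gt0// mulrC.
    by have [] := keym k%:Z.
  - have -> : (1 : R) = (mh - ml) / (mh - ml) by rewrite divff// gt_eqF// subr_gt0.
    apply: cvgM; last exact: cvg_cst.
    by apply: cvgB => //; exact: cvg_cst.
  - exact: cvg_cst.
have al1 : al (- k%:Z) @[k --> \oo] --> (1 : R).
  apply: (@squeeze_cvgr _ _ _ _ (fun k : nat => (n (- k%:Z) - nh) / (nl - nh)) (fun=> 1)).
  - apply: nearW => k; rewrite al_le1 andbT ler_pdivrMr ?subr_gt0// mulrC.
    by have [] := keyn (- k%:Z).
  - have -> : (1 : R) = (nl - nh) / (nl - nh) by rewrite divff// gt_eqF// subr_gt0.
    apply: cvgM; last exact: cvg_cst.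
    by apply: cvgB => //; exact: cvg_cst.
  - exact: cvg_cst.
have al0 : al k%:Z @[k --> \oo] --> (0 : R).
  have -> : al = fun k => 1 - be k.
    by apply/funext => k; have [<- _ _] := keym k; rewrite addrK.
  by rewrite -[X in _ --> X](subrr 1); apply: cvgB => //; exact: cvg_cst.
have be0 : be (- k%:Z) @[k --> \oo] --> (0 : R).
  have -> : be = fun k => 1 - al k.
    by apply/funext => k; have [<- _ _] := keym k; rewrite addrAC subrr add0r.
  by rewrite -[X in _ --> X](subrr 1); apply: cvgB => //; exact: cvg_cst.
have keyb k : be k * (1 - mh + ml) = ml by have [] := keym k.
have keya k : al k * (x - nl + nh) = nh by have [] := keyn k.
(* The limits 0 and 1 of [be] give [ml = 0] and [mh = 1]; those of [al] give [nh = 0] and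
   [nl = x]. *)
have eq1 := lim_affine_cst be1 keyb; have eq2 := lim_affine_cst be0 keyb.
have eq3 := lim_affine_cst al1 keya; have eq4 := lim_affine_cst al0 keya.
have ml0 : ml = 0 by lra.
have mh1 : mh = 1 by lra.
have nh0 : nh = 0 by lra.
have nlx : nl = x by lra.
exists m, n; split; last by rewrite -nlx.
by split => //; [rewrite -ml0|rewrite -nh0|rewrite -mh1].
Qed.

End NashConverse.

(** * The map s *)

Lemma int_bi_ind (Q : int -> Prop) : Q 0 ->
  (forall i, Q i -> Q (i + 1)) -> (forall i, Q i -> Q (i - 1)) -> forall i, Q i.
Proof.
move=> Q0 Qp Qm; case; elim=> [|k IH] //.
- by have := Qp _ IH; rewrite addrC -intS.
- by have := Qm _ Q0.
- by have := Qm _ IH; have -> : Negz k - 1 = Negz k.+1 by lia.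
Qed.

Section Orbit.
Context {R : realType}.
Implicit Types (x r z : R).

(** The positive root [r] of [r * (1 + 2 * r) = x]: the ratio of stakes at a site, recovered from
    the ratio of increments. *)
Definition stake_ratio x : R := (Num.sqrt (8 * x + 1) - 1) / 4.

Lemma sqrt_ratio r : 0 < r -> Num.sqrt (8 * (r * (1 + 2 * r)) + 1) = 4 * r + 1.
Proof.
move=> r0; have -> : 8 * (r * (1 + 2 * r)) + 1 = (4 * r + 1) ^+ 2 by ring.
by rewrite sqrtr_sqr ger0_norm//; lra.
Qed.

Lemma stake_ratioK r : 0 < r -> stake_ratio (r * (1 + 2 * r)) = r.
Proof. by move=> r0; rewrite /stake_ratio sqrt_ratio//; field. Qed.

Lemma stake_ratioP x : 0 < x ->
  0 < stake_ratio x /\ stake_ratio x * (1 + 2 * stake_ratio x) = x.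
Proof.
move=> x0; rewrite /stake_ratio; set w := Num.sqrt _.
have w2 : w ^+ 2 = 8 * x + 1 by rewrite sqr_sqrtr//; lra.
have w0 : 0 <= w by exact: sqrtr_ge0.
split; first by apply: divr_gt0 => //; nra.
have -> : (w - 1) / 4 * (1 + 2 * ((w - 1) / 4)) = (w ^+ 2 - 1) / 8 by field.
by rewrite w2; field.
Qed.

(** In this parameter the square root disappears and [s_map] becomes rational. *)
Lemma s_map_ratio r : 0 < r -> s_map (r * (1 + 2 * r)) = r ^+ 2 / (2 + r).
Proof.
move=> r0; rewrite /s_map sqrt_ratio//; field.
by apply/andP; split; rewrite gt_eqF//; lra.
Qed.

Lemma ratio_pos r : 0 < r -> 0 < r * (1 + 2 * r).
Proof. by move=> r0; rewrite mulr_gt0//; lra. Qed.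

Lemma s_map_pos x : 0 < x -> 0 < s_map x.
Proof.
move=> /stake_ratioP[r0 <-]; rewrite s_map_ratio// divr_gt0 ?exprn_gt0//; lra.
Qed.

(** Inversion of the argument corresponds to [r^-1], so the definition through [s_map] is the
    formula of [s_map_ratio] at [r^-1]. *)
Lemma s_inv_ratio r : 0 < r -> s_inv (r ^+ 2 / (2 + r)) = r * (1 + 2 * r).
Proof.
move=> r0; rewrite /s_inv.
have q0 : 0 < r^-1 by rewrite invr_gt0.
have nz : r != 0 by rewrite gt_eqF.
have nz2 : 2 + r != 0 by rewrite gt_eqF//; lra.
have -> : (r ^+ 2 / (2 + r))^-1 = r^-1 * (1 + 2 * r^-1).
  by field; rewrite nz.
rewrite s_map_ratio//; field.
by rewrite nz /= gt_eqF//; lra.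
Qed.

Lemma s_mapK x : 0 < x -> s_inv (s_map x) = x.
Proof.
by move=> /stake_ratioP[r0 e]; rewrite -{1}e s_map_ratio// s_inv_ratio.
Qed.

Lemma s_inv_pos x : 0 < x -> 0 < s_inv x.
Proof. by move=> x0; rewrite invr_gt0 s_map_pos// invr_gt0. Qed.

Lemma s_invK x : 0 < x -> s_map (s_inv x) = x.
Proof.
move=> x0; have y0 : 0 < x^-1 by rewrite invr_gt0.
have := s_mapK y0; rewrite /s_inv => /(congr1 (@GRing.inv R)).
by rewrite !invrK.
Qed.

(** In the ratio [r] this is [0 <= 2 * (r - 1) ^+ 2], with equality at [x = 3]. *)
Lemma s_map_le x : 0 < x -> s_map x <= x / 9.
Proof.
move=> /stake_ratioP[]; move: (stake_ratio x) => r r0 <-; rewrite s_map_ratio//.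
rewrite ler_pdivrMr; last lra.
have := sqr_ge0 (r - 1); have := ltW r0; nra.
Qed.

Lemma s_iter_pos (k : int) z : 0 < z -> 0 < s_iter k z.
Proof.
move=> z0; case: k => k /=; first by elim: k => //= k; exact: s_map_pos.
by apply: s_inv_pos; elim: k => //= k; exact: s_inv_pos.
Qed.

Lemma s_iterS (k : int) z : 0 < z -> s_iter (k + 1) z = s_map (s_iter k z).
Proof.
move=> z0; case: k => k; first by rewrite addrC -intS.
case: k => [|k]; first by rewrite /= s_invK.
have -> : Negz k.+1 + 1 = Negz k by lia.
by rewrite [in RHS]/= s_invK// (s_iter_pos (Negz k) z0).
Qed.

Lemma s_iter_pred (k : int) z : 0 < z -> s_iter (k - 1) z = s_inv (s_iter k z).
Proof.
by move=> z0; rewrite -{2}(subrK 1 k) s_iterS// s_mapK// s_iter_pos.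
Qed.

Lemma s_iterD (j k : int) z : 0 < z -> s_iter (k + j) z = s_iter k (s_iter j z).
Proof.
move=> z0; elim/int_bi_ind: k => [|k IH|k IH]; first by rewrite add0r.
  by rewrite addrAC !s_iterS ?s_iter_pos// IH.
by rewrite addrAC !s_iter_pred ?s_iter_pos// IH.
Qed.

(** The decay is geometric; this weaker linear form matches the Archimedean bound [Num.bound]
    directly. *)
Lemma s_iter_small (k : nat) z : 0 < z -> s_iter k%:Z z * k.+1%:R <= z.
Proof.
move=> z0; elim: k => [|k IH]; first by rewrite mulr1.
have y0 := s_iter_pos k%:Z z0.
have := s_map_le y0; rewrite -s_iterS// => le1.
have -> : k.+1%:Z = k%:Z + 1 by lia.
apply: le_trans IH; rewrite -(natr1 k.+1).
have k0 : (1 : R) <= k.+1%:R by rewrite ler1n.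
have w0 := s_iter_pos (k%:Z + 1) z0.
nra.
Qed.

Lemma s_iter_large (k : nat) z : 0 < z -> z * k.+1%:R <= s_iter (- k%:Z) z.
Proof.
move=> z0; elim: k => [|k IH]; first by rewrite mulr1.
have -> : - k.+1%:Z = - k%:Z - 1 by lia.
have y0 := s_iter_pos (- k%:Z - 1) z0.
have := s_map_le y0; rewrite -s_iterS// subrK => le1.
rewrite -(natr1 k.+1).
have k0 : (1 : R) <= k.+1%:R by rewrite ler1n.
nra.
Qed.

(** Far back the orbit exceeds 3. At the first later index where it is at most 3, its predecessor
    still exceeds 3, so it exceeds [s_map 3 = 3^-1]. *)
Lemma s_iter_fundamental z : 0 < z -> exists k : int, 3^-1 < s_iter k z <= 3.
Proof.
move=> z0.
have [K hK] : exists K : nat, 3 < s_iter (- K%:Z) z.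
  exists (Num.bound (3 / z)).
  apply: lt_le_trans (s_iter_large _ z0); rewrite -ltr_pdivrMl// mulrC.
  have := archi_boundP (divr_ge0 (ler0n R 3) (ltW z0)) => h.
  by apply: lt_trans h _; rewrite ltr_nat.
have [L hL] : exists L : nat, s_iter (- K%:Z + L%:Z) z <= 3.
  exists (K + Num.bound (z / 3))%N.
  have -> : - K%:Z + (K + Num.bound (z / 3))%N%:Z = (Num.bound (z / 3))%:Z by lia.
  have := s_iter_small (Num.bound (z / 3)) z0.
  have := archi_boundP (divr_ge0 (ltW z0) (ler0n R 3)) => h h'.
  have p0 : (0 : R) < (Num.bound (z / 3)).+1%:R by rewrite ltr0n.
  rewrite -(ler_pM2r p0); apply: le_trans h' _.
  rewrite mulrC -ler_pdivrMr//; apply: le_trans (ltW h) _.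
  by rewrite ler_nat.
have ex : exists L : nat, s_iter (- K%:Z + L%:Z) z <= 3 by exists L.
case: (ex_minnP ex) => -[|N] hN minN.
  by move: hN; rewrite addr0 leNgt hK.
exists (- K%:Z + N.+1%:Z); rewrite hN andbT.
have -> : - K%:Z + N.+1%:Z = (- K%:Z + N%:Z) + 1 by lia.
rewrite s_iterS//; set y := s_iter _ z.
have y3 : 3 < y.
  by rewrite ltNge; apply/negP => /minN; rewrite ltnn.
have y0 : 0 < y by lra.
have [r0 e] := stake_ratioP y0; rewrite -e s_map_ratio//.
move: (stake_ratio y) r0 e => r r0 e; rewrite ltr_pdivlMr; last lra.
by nra.
Qed.

End Orbit.

(** * Standard solutions *)

Section StandardSolutions.
Context {R : realType}.
Implicit Types (a b m n f : int -> R) (z : R).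

Definition site_ratio m n (i : int) : R := (n (i - 1) - n i) / (m i - m (i - 1)).

Lemma positive_site_ratio a b m n i : positive_ABMN a b m n ->
  0 < b i / a i /\
  site_ratio m n i = (b i / a i) * (1 + 2 * (b i / a i)) /\
  site_ratio m n (i + 1) = s_map (site_ratio m n i).
Proof.
move=> h; have [a0 b0] := h.2 i; have [e1 e2 e3 e4] := positive_ABMN_increments i h.
have r0 : 0 < b i / a i by rewrite divr_gt0.
have na : a i != 0 by rewrite gt_eqF.
have nb : b i != 0 by rewrite gt_eqF.
have e : site_ratio m n i = (b i / a i) * (1 + 2 * (b i / a i)).
  by rewrite /site_ratio e1 e3; field; rewrite na.
split => //; split => //; rewrite e s_map_ratio// /site_ratio addrK e2 e4.
by field; rewrite na /= gt_eqF//; lra.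
Qed.

Lemma central_ratioE m n : central_ratio m n = site_ratio m n 0.
Proof. by rewrite /central_ratio /site_ratio sub0r. Qed.

Lemma site_ratio_pos a b m n i : positive_ABMN a b m n -> 0 < site_ratio m n i.
Proof.
by move=> h; have [r0 [-> _]] := positive_site_ratio i h; exact: ratio_pos.
Qed.

Lemma site_ratioE a b m n i : positive_ABMN a b m n ->
  site_ratio m n i = s_iter i (central_ratio m n).
Proof.
move=> h; have z0 : 0 < central_ratio m n.
  by rewrite central_ratioE; exact: (site_ratio_pos 0 h).
elim/int_bi_ind: i => [|i IH|i IH]; first by rewrite central_ratioE.
  by rewrite s_iterS// -IH; have [_ []] := positive_site_ratio i h.
rewrite s_iter_pred// -IH; have [_ [_ ]] := positive_site_ratio (i - 1) h.
by rewrite subrK => ->; rewrite s_mapK// (site_ratio_pos _ h).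
Qed.

Lemma int_const f : (forall i, f (i + 1) = f i) -> forall i, f i = f 0.
Proof.
move=> h i; elim/int_bi_ind: i => [//|i IH|i IH]; first by rewrite h.
by rewrite -IH -[in RHS](subrK 1 i) h.
Qed.

Lemma lim_pinfty_unique f l l' : lim_pinfty f l -> lim_pinfty f l' -> l = l'.
Proof. by move=> h h'; apply: cvg_unique h h'. Qed.

Lemma lim_ninfty_unique f l l' : lim_ninfty f l -> lim_ninfty f l' -> l = l'.
Proof. by move=> h h'; apply: cvg_unique h h'. Qed.

(** Equal central ratios make all ratios of stakes equal, so the stakes of the two solutions are
    proportional and [m'] is an affine image of [m]. The limits 0 and 1 of [m] fix both constants,
    and the limit of [n] at the right end fixes the remaining additive one. *)
Lemma standard_unique a b m n a' b' m' n' :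
  standard_ABMN a b m n -> standard_ABMN a' b' m' n' ->
  central_ratio m n = central_ratio m' n' ->
  [/\ a = a', b = b', m = m' & n = n'].
Proof.
move=> [h md nu mu] [h' md' nu' mu'] ez.
have er i : b i / a i = b' i / a' i.
  have [r0 [e _]] := positive_site_ratio i h.
  have [r0' [e' _]] := positive_site_ratio i h'.
  rewrite -(stake_ratioK r0) -(stake_ratioK r0') -e -e'.
  by rewrite (site_ratioE i h) (site_ratioE i h') ez.
pose C := a' 0 / a 0.
have ap i : 0 < a i by have [] := h.2 i.
have ap' i : 0 < a' i by have [] := h'.2 i.
have be i : b i = b i / a i * a i by rewrite divfK// gt_eqF.
have be' i : b' i = b i / a i * a' i by rewrite er divfK// gt_eqF.
have rp i : 0 < b i / a i by have [] := positive_site_ratio i h.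
(* The two stake sequences satisfy the same first-order linear recursion. *)
have rec i : a (i + 1) / (b (i + 1) / a (i + 1)) = a i * (2 + b i / a i).
  have [_ e1 _ _] := positive_ABMN_increments i h.
  have [e2 _ _ _] := positive_ABMN_increments (i + 1) h.
  move: e2; rewrite addrK e1 [in RHS]be => e2.
  have -> : a i * (2 + b i / a i) = 2 * a i + b i by rewrite [in RHS]be; ring.
  have nr : b (i + 1) / a (i + 1) != 0 by rewrite gt_eqF.
  by rewrite e2; move: (b (i + 1) / a (i + 1)) nr => r nr; field; rewrite nr gt_eqF.
have rec' i : a' (i + 1) / (b (i + 1) / a (i + 1)) = a' i * (2 + b i / a i).
  have [_ e1 _ _] := positive_ABMN_increments i h'.
  have [e2 _ _ _] := positive_ABMN_increments (i + 1) h'.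
  move: e2; rewrite addrK e1 [in RHS]be' => e2.
  have -> : a' i * (2 + b i / a i) = 2 * a' i + b' i by rewrite [in RHS]be'; ring.
  have nr : b (i + 1) / a (i + 1) != 0 by rewrite gt_eqF.
  by rewrite e2; move: (b (i + 1) / a (i + 1)) nr => r nr; field; rewrite nr gt_eqF.
have aC i : a' i = C * a i.
  suff : a' i / a i = a' 0 / a 0 by move=> e; rewrite /C -e divfK// gt_eqF.
  apply: (int_const (f := fun i => a' i / a i)) => {}i.
  have nr : b (i + 1) / a (i + 1) != 0 by rewrite gt_eqF.
  have E : a (i + 1) = a i * (2 + b i / a i) * (b (i + 1) / a (i + 1)).
    by rewrite -rec divfK.
  have E' : a' (i + 1) = a' i * (2 + b i / a i) * (b (i + 1) / a (i + 1)).
    by rewrite -rec' divfK.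
  have n2 : 2 + b i / a i != 0 by rewrite gt_eqF// addr_gt0.
  move: (b (i + 1) / a (i + 1)) (b i / a i) nr n2 E E' => r r' nr n2 -> ->.
  by field; rewrite nr n2 gt_eqF.
have bC i : b' i = C * b i by rewrite be' aC [in RHS]be; ring.
have mC i : m' i - C * m i = m' 0 - C * m 0.
  apply: (int_const (f := fun i => m' i - C * m i)) => {}i.
  have [_ e1 _ _] := positive_ABMN_increments i h.
  have [_ e2 _ _] := positive_ABMN_increments i h'.
  have -> : m (i + 1) = m i + (2 * a i + b i) by lra.
  have -> : m' (i + 1) = m' i + (2 * (C * a i) + C * b i).
    by rewrite -aC -bC; lra.
  ring.
pose K := m' 0 - C * m 0.
have m'E : m' = fun i => C * m i + K.
  by apply/funext => i; rewrite /K -(mC i); ring.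
have limd : lim_ninfty m' (C * 0 + K).
  by rewrite m'E; apply: cvgD; [apply: cvgM => //; exact: cvg_cst|exact: cvg_cst].
have limu : lim_pinfty m' (C * 1 + K).
  by rewrite m'E; apply: cvgD; [apply: cvgM => //; exact: cvg_cst|exact: cvg_cst].
have K0 : K = 0 by have := lim_ninfty_unique md' limd; lra.
have C1 : C = 1 by have := lim_pinfty_unique mu' limu; lra.
have ea : a = a' by apply/funext => i; rewrite aC C1 mul1r.
have eb : b = b' by apply/funext => i; rewrite bC C1 mul1r.
have em : m = m' by rewrite m'E K0 C1; apply/funext => i; rewrite mul1r addr0.
split => //.
have nC i : n' i - n i = n' 0 - n 0.
  apply: (int_const (f := fun i => n' i - n i)) => {}i.
  have [_ _ _ e1] := positive_ABMN_increments i h.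
  have [_ _ _ e2] := positive_ABMN_increments i h'.
  rewrite -ea -eb in e2; lra.
have n'E : n' = fun i => n i + (n' 0 - n 0).
  by apply/funext => i; rewrite -(nC i); ring.
have limn : lim_pinfty n' (0 + (n' 0 - n 0)).
  by rewrite {1}n'E; apply: cvgD => //; exact: cvg_cst.
have N0 : n' 0 - n 0 = 0 by have := lim_pinfty_unique nu' limn; lra.
by rewrite n'E N0; apply/funext => i; rewrite addr0.
Qed.

(** * Construction of standard solutions from their central ratio *)

Lemma int_recursion (rho : int -> R) : (forall i, 0 < rho i) ->
  exists mu : int -> R, forall i, 0 < mu i /\ mu (i + 1) = rho i * mu i.
Proof.
move=> rho0.
(* Normalised to 1 at 0; [Negz k] stands for [- k.+1], hence [k.+1] inverted factors. *)
exists (fun i => match i with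
  | Posz k => \prod_(0 <= j < k) rho j%:Z
  | Negz k => (\prod_(0 <= j < k.+1) rho (Negz j))^-1 end).
case=> k; (split; first by rewrite ?invr_gt0 prodr_gt0).
  have -> : Posz k + 1 = Posz k.+1 by lia.
  by rewrite big_nat_recr//= mulrC.
case: k => [|k].
  have -> : Negz 0 + 1 = Posz 0 by [].
  by rewrite big_geq// big_nat1 divff// gt_eqF.
have -> : Negz k.+1 + 1 = Negz k by lia.
rewrite [X in _ = _ * X^-1]big_nat_recr//= invfM mulrCA divff ?mulr1//.
by rewrite gt_eqF.
Qed.

Lemma int_primitive (inc : int -> R) :
  exists S : int -> R, forall i, S i - S (i - 1) = inc i.
Proof.
exists (fun i => match i with
  | Posz k => \sum_(0 <= j < k) inc j.+1%:Z
  | Negz k => - \sum_(0 <= j < k.+1) inc (- j%:Z) end).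
case=> [[|k]|k].
- by rewrite /= big_nil big_nat1 oppr0 sub0r opprK.
- have -> : Posz k.+1 - 1 = Posz k by lia.
  by rewrite big_nat_recr//= addrAC subrr add0r.
have -> : Negz k - 1 = Negz k.+1 by lia.
rewrite [X in _ - - X]big_nat_recr//= opprK addKr.
by congr inc; lia.
Qed.

(** Halving bounds the variation of [S] by geometric series. Beyond a far right site [i] it is at
    most [inc i]; to the left the step at [i] itself counts too, whence [2 * inc i]. *)
Lemma primitive_cvg (S inc : int -> R) (K : nat) :
  (forall i, 0 < inc i) -> (forall i, S i - S (i - 1) = inc i) ->
  (forall k : nat, (K <= k)%N -> inc (k%:Z + 1) <= inc k%:Z / 2) ->
  (forall k : nat, (K <= k)%N -> inc (- k%:Z - 1) <= inc (- k%:Z) / 2) ->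
  (forall i, S i <= S (i + 1)) /\
  (exists lo, lim_ninfty S lo) /\ (exists hi, lim_pinfty S hi).
Proof.
move=> i0 Sinc hu hd.
have Smono i : S i <= S (i + 1).
  by rewrite -subr_ge0; have := Sinc (i + 1); rewrite addrK => ->; exact: ltW.
split => //.
have up (j : nat) : S (K + j)%:Z + inc (K + j)%:Z <= S K%:Z + inc K%:Z.
  elim: j => [|j IH]; first by rewrite addn0.
  apply: le_trans IH; rewrite addnS.
  have -> : (K + j).+1%:Z = (K + j)%:Z + 1 by lia.
  have := Sinc ((K + j)%:Z + 1); rewrite addrK.
  have := hu (K + j)%N (leq_addr _ _); lra.
have dn (j : nat) : S (- K%:Z) - 2 * inc (- K%:Z) <=
    S (- (K + j)%:Z) - 2 * inc (- (K + j)%:Z).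
  elim: j => [|j IH]; first by rewrite addn0.
  apply: le_trans IH _; rewrite addnS.
  have -> : - (K + j).+1%:Z = - (K + j)%:Z - 1 by lia.
  have := Sinc (- (K + j)%:Z).
  have := hd (K + j)%N (leq_addr _ _); lra.
apply: (mono_bounded_cvg (l := S (- K%:Z) - 2 * inc (- K%:Z))
                         (u := S K%:Z + inc K%:Z) Smono) => i.
apply/andP; split.
  apply: (@le_trans _ _ (S (- (K + `|i|)%N%:Z))).
    have := dn `|i|%N; have := i0 (- (K + `|i|)%N%:Z); lra.
  by apply: (mono_int Smono); lia.
apply: (@le_trans _ _ (S (K + `|i|)%N%:Z)).
  by apply: (mono_int Smono); lia.
have := up `|i|%N; have := i0 (K + `|i|)%N%:Z; lra.
Qed.

(** The orbit of [z] prescribes the ratios [r], and with them the recursion for the increments [mu]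
    of [m] and [nu] of [n]. Summation yields [m] and [n] up to an affine normalisation. *)
Lemma standard_exists z : 0 < z ->
  exists a b m n l, [/\ standard_ABMN a b m n, central_ratio m n = z &
    lim_ninfty n l].
Proof.
move=> z0; pose phi i := s_iter i z; pose r i := stake_ratio (phi i).
have phi0 i : 0 < phi i by exact: s_iter_pos.
have r0 i : 0 < r i by have [] := stake_ratioP (phi0 i).
have rE i : r i * (1 + 2 * r i) = phi i by have [] := stake_ratioP (phi0 i).
have phiS i : phi (i + 1) = r i ^+ 2 / (2 + r i).
  by rewrite /phi s_iterS// -/(phi i) -rE s_map_ratio.
(* If [mu i] is the increment of [m] before site [i], the stakes there are [r i * mu i] and
   [r i ^+ 2 * mu i], and the next increment [2 * a i + b i] is the one prescribed. *)
have [mu hmu] : exists mu : int -> R,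
    forall i, 0 < mu i /\ mu (i + 1) = r i * (2 + r i) * mu i.
  apply: int_recursion => i; have := r0 i => ri; rewrite mulr_gt0//; lra.
have mu0 i : 0 < mu i by have [] := hmu i.
have muS i : mu (i + 1) = r i * (2 + r i) * mu i by have [] := hmu i.
pose nu i := phi i * mu i.
have nu0 i : 0 < nu i by rewrite mulr_gt0.
have nuS i : nu (i + 1) = r i ^+ 3 * mu i.
  rewrite /nu phiS muS; have := r0 i => ri.
  by field; rewrite gt_eqF//; lra.
have nuE i : nu i = (r i + 2 * r i ^+ 2) * mu i by rewrite /nu -rE; ring.
(* Ratios of at most 1/5 on the right and at least 5 on the left make the increments of both [m] and
   [n] at least halve outwards, as [primitive_cvg] asks. *)
have [K1 small] : exists K : nat, forall k : nat, (K <= k)%N -> r k%:Z <= 5^-1.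
  exists (Num.bound (z * 5)) => k Kk.
  have lt1 : z * 5 < k.+1%:R.
    have := archi_boundP (mulr_ge0 (ltW z0) (ler0n R 5)) => h.
    by apply: lt_trans h _; rewrite ltr_nat ltnS.
  have := s_iter_small k z0; rewrite -/(phi k%:Z) => le1.
  have k0 : (0 : R) < k.+1%:R by rewrite ltr0n.
  have := rE k%:Z; have := r0 k%:Z; move: (r k%:Z) (phi k%:Z) le1 => s f le1 s0 sf.
  have fs : s <= f by nra.
  by apply: le_trans fs (ltW _); rewrite -(ltr_pM2r k0); lra.
have [K2 large] : exists K : nat, forall k : nat, (K <= k)%N -> 5 <= r (- k%:Z - 1).
  (* The number 55 is [r * (1 + 2 * r)] at [r = 5]. *)
  exists (Num.bound (55 / z)) => k Kk.
  have lt1 : 55 < z * k.+2%:R.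
    rewrite -ltr_pdivrMl// mulrC.
    have := archi_boundP (divr_ge0 (ler0n R 55) (ltW z0)) => h.
    by apply: lt_trans h _; rewrite ltr_nat ltnS leqW.
  have := s_iter_large k.+1 z0.
  have -> : - k.+1%:Z = - k%:Z - 1 by lia.
  rewrite -/(phi _) -rE; have := r0 (- k%:Z - 1).
  move: (r _) => s s0 le1; rewrite leNgt; apply/negP => s5; nra.
have [Sm Sminc] := int_primitive mu; have [Sn Sninc] := int_primitive nu.
have [Smono [[mlo mloP] [mhi mhiP]]] : (forall i, Sm i <= Sm (i + 1)) /\
    (exists lo, lim_ninfty Sm lo) /\ (exists hi, lim_pinfty Sm hi).
  apply: (primitive_cvg (K := maxn K1 K2) mu0 Sminc) => k; rewrite geq_max => /andP[h1 h2].
    rewrite muS; have := small k h1; have := r0 k%:Z; have := mu0 k%:Z.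
    move: (r _) (mu _) => s u u0 s0 s5; rewrite mulrC ler_pM2l//; nra.
  have := muS (- k%:Z - 1); rewrite subrK => ->.
  have := large k h2; have := mu0 (- k%:Z - 1); move: (r _) (mu _) => s u u0 s5; nra.
have [_ [[nlo nloP] [nhi nhiP]]] : (forall i, Sn i <= Sn (i + 1)) /\
    (exists lo, lim_ninfty Sn lo) /\ (exists hi, lim_pinfty Sn hi).
  apply: (primitive_cvg (K := maxn K1 K2) nu0 Sninc) => k; rewrite geq_max => /andP[h1 h2].
    rewrite nuS nuE; have := small k h1; have := r0 k%:Z; have := mu0 k%:Z.
    move: (r _) (mu _) => s u u0 s0 s5.
    have -> : s ^+ 3 * u = (s * u) * s ^+ 2 by ring.
    have -> : (s + 2 * s ^+ 2) * u / 2 = (s * u) * ((1 + 2 * s) / 2) by field.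
    by rewrite ler_pM2l ?mulr_gt0//; nra.
  have := nuS (- k%:Z - 1); rewrite subrK => ->; rewrite nuE.
  have := large k h2; have := mu0 (- k%:Z - 1); move: (r _) (mu _) => s u u0 s5.
  have su0 : 0 < s * u by rewrite mulr_gt0//; lra.
  have -> : s ^+ 3 * u / 2 = (s * u) * (s ^+ 2 / 2) by field.
  have -> : (s + 2 * s ^+ 2) * u = (s * u) * (1 + 2 * s) by ring.
  by rewrite ler_pM2l//; nra.
(* The system is homogeneous, so dividing by the total rise of [Sm] gives [m] the limits 0 and 1. *)
pose D := mhi - mlo.
have D0 : 0 < D.
  rewrite subr_gt0; apply: le_lt_trans (mono_lim_ninfty Smono mloP (0 - 1)) _.
  apply: lt_le_trans (mono_lim_pinfty Smono mhiP 0).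
  by rewrite -subr_gt0 Sminc.
have nD : D != 0 by rewrite gt_eqF.
pose a i := r i * mu i / D; pose b i := r i ^+ 2 * mu i / D.
pose m i := (Sm i - mlo) / D; pose n i := (nhi - Sn i) / D.
have pos : positive_ABMN a b m n.
  apply: increments_ABMN => i.
    by split; rewrite divr_gt0// mulr_gt0// exprn_gt0.
  have ri := r0 i; have ui := mu0 i.
  have nr : r i != 0 by rewrite gt_eqF.
  have nmu : mu i != 0 by rewrite gt_eqF.
  have em : m i - m (i - 1) = mu i / D by rewrite -Sminc /m; field.
  have em' : m (i + 1) - m i = r i * (2 + r i) * mu i / D.
    by rewrite -muS -Sminc addrK /m; field.
  have en : n (i - 1) - n i = (r i + 2 * r i ^+ 2) * mu i / D.
    by rewrite -nuE -Sninc /n; field.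
  have en' : n i - n (i + 1) = r i ^+ 3 * mu i / D.
    by rewrite -nuS -Sninc addrK /n; field.
  rewrite em em' en en' /a /b; split.
  - by field; rewrite nD nr nmu.
  - by field.
  - by field.
  - by field; rewrite nD nr nmu.
exists a, b, m, n, ((nhi - nlo) / D); split.
- split => //.
  + rewrite /lim_ninfty -[X in _ --> X](mul0r D^-1) -[X in X / D](subrr mlo).
    by apply: cvgM; [apply: cvgB => //|]; exact: cvg_cst.
  + rewrite /lim_pinfty -[X in _ --> X](mul0r D^-1) -[X in X / D](subrr nhi).
    by apply: cvgM; [apply: cvgB => //|]; exact: cvg_cst.
  + have -> : (1 : R) = (mhi - mlo) / D by rewrite divff.
    by apply: cvgM; [apply: cvgB => //|]; exact: cvg_cst.
- rewrite central_ratioE /site_ratio.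
  have -> : n (0 - 1) - n 0 = phi 0 * mu 0 / D by rewrite -/(nu 0) -Sninc /n; field.
  have -> : m 0 - m (0 - 1) = mu 0 / D by rewrite -Sminc /m; field.
  have nmu : mu 0 != 0 by rewrite gt_eqF.
  have -> : phi 0 = z by [].
  by field; rewrite nD nmu.
- by apply: cvgM; [apply: cvgB => //|]; exact: cvg_cst.
Qed.

(** By uniqueness, the solution selected by choice is whichever one is at hand. *)
Lemma st_solE a b m n z : standard_ABMN a b m n -> central_ratio m n = z ->
  st_sol z = (a, b, m, n).
Proof.
move=> h ez; rewrite /st_sol; case: pselect => [H|[]]; last first.
  by exists (a, b, m, n).
case: (cid H) => -[[[a' b'] m'] n'] /= [h' ez'].
by have [-> -> -> ->] := standard_unique h' h (etrans ez' (esym ez)).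
Qed.

Lemma McalE a b m n z l : standard_ABMN a b m n -> central_ratio m n = z ->
  lim_ninfty n l -> Mcal z = l.
Proof. by move=> h ez nl; rewrite /Mcal /n_st (st_solE h ez)/=; exact: cvg_lim nl. Qed.

Lemma lim_pinfty_shift f l (j : int) :
  lim_pinfty f l -> lim_pinfty (fun i => f (i + j)) l.
Proof.
move=> fl; apply: (tends_up_lim fl) => M.
by exists `|M - j|%N => t; lia.
Qed.

Lemma lim_ninfty_shift f l (j : int) :
  lim_ninfty f l -> lim_ninfty (fun i => f (i + j)) l.
Proof.
move=> fl; apply: (tends_down_lim fl) => M.
by exists `|M - j|%N => t; lia.
Qed.

Lemma standard_shift a b m n (j : int) : standard_ABMN a b m n ->
  standard_ABMN (fun i => a (i + j)) (fun i => b (i + j))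
                (fun i => m (i + j)) (fun i => n (i + j)).
Proof.
move=> [[h pos] md nu mu]; split; first split.
- by move=> i; have := h (i + j); rewrite (addrAC i j 1) (addrAC i j (-1)).
- by move=> i; exact: pos.
- exact: lim_ninfty_shift.
- exact: lim_pinfty_shift.
- exact: lim_pinfty_shift.
Qed.

(** The shift by [j] of the solution for [z] is again standard, has the same limits, and its central
    ratio is the ratio of the original at site [j], that is [s_iter j z]. *)
Lemma st_sol_orbit z (j : int) : 0 < z ->
  [/\ a_st (s_iter j z) = (fun i => a_st z (i + j)),
      b_st (s_iter j z) = (fun i => b_st z (i + j)) &
      Mcal (s_iter j z) = Mcal z].
Proof.
move=> /standard_exists[a [b [m [n [l [h ez nl]]]]]].
have h' := standard_shift j h.
have ez' : central_ratio (fun i => m (i + j)) (fun i => n (i + j)) = s_iter j z.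
  have [pos _ _ _] := h; rewrite -ez -(site_ratioE j pos).
  by rewrite central_ratioE /site_ratio !add0r (addrC (-1) j).
rewrite (McalE h ez nl) (McalE h' ez' (lim_ninfty_shift j nl)).
by rewrite /a_st /b_st (st_solE h ez) (st_solE h' ez').
Qed.

End StandardSolutions.

Theorem mainTheorem15 (R : realType) (d : measure_display)
  (T : measurableType d) (P : probability T R) (U : nat -> T -> R)
  (mst nst x : R) :
  iid_uniform P U ->
  mst <= 0 -> nst <= 0 ->
  (lambda : R) <= x <= (lambda : R)^-1 ->
  let X := [set z : R | 0 < z /\ Mcal z = x] in
  let Y := X `&` `]3^-1, 3] in
  [/\ X = \bigcup_(k in [set: int]) (s_iter k @` Y),
      (forall b a : int -> R, (forall i, 0 <= b i /\ 0 <= a i) ->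
         (Nash_equilibrium P U 0 1 x 0 mst nst (ti_mina b) (ti_maxine a)
          <-> exists2 z, X z & b = b_st z /\ a = a_st z)) &
      (forall b a : int -> R, (forall i, 0 <= b i /\ 0 <= a i) ->
         (Nash_equilibrium P U 0 1 x 0 mst nst (ti_mina b) (ti_maxine a)
          <-> exists y (j : int), [/\ Y y, b = (fun i => b_st y (i + j))
                                   & a = (fun i => a_st y (i + j))]))].
Proof.
move=> hU hm hn _ X Y.
have XE : X = \bigcup_(k in [set: int]) (s_iter k @` Y).
  apply/seteqP; split => [z [z0 Mz]|_ [k _ [y [[y0 My] _] <-]]]; last first.
    by split; [exact: s_iter_pos|have [_ _ ->] := st_sol_orbit k y0].
  have [k hk] := s_iter_fundamental z0.
  exists (- k) => //; exists (s_iter k z).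
    split; last by rewrite /= in_itv.
    by split; [exact: s_iter_pos|have [_ _ ->] := st_sol_orbit k z0].
  by rewrite -s_iterD// addNr.
have NashE (b a : int -> R) : (forall i, 0 <= b i /\ 0 <= a i) ->
    (Nash_equilibrium P U 0 1 x 0 mst nst (ti_mina b) (ti_maxine a)
     <-> exists2 z, X z & b = b_st z /\ a = a_st z).
  move=> ab0; split => [NE|[z [z0 Mz] [-> ->]]].
    have [m [n [h nx]]] := Nash_standard hU ab0 hm NE.
    (* [m] and [n] are the players' values, and uniqueness identifies the solution they form with
       [st_sol]. *)
    exists (central_ratio m n).
      split; last exact: (McalE h erefl nx).
      by have [pos _ _ _] := h; rewrite central_ratioE; exact: site_ratio_pos pos.
    by rewrite /b_st /a_st (st_solE h erefl).
  have [a' [b' [m [n [l [h ez nl]]]]]] := standard_exists z0.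
  rewrite /a_st /b_st (st_solE h ez) /=.
  by apply: (standard_Nash hU h) => //; rewrite -Mz (McalE h ez nl).
(* Each point of [X] is [s_iter j y] with [y] in [Y], and [st_sol_orbit] turns the iterate into a
   shift of the stakes by [j]. *)
split => // b a ab0; rewrite NashE//; split.
  move=> [z]; rewrite XE => -[j _ [y Yy <-]] [-> ->].
  have [[y0 _] _] := Yy; have [-> -> _] := st_sol_orbit j y0.
  by exists y, j.
move=> [y [j [Yy -> ->]]]; exists (s_iter j y).
  by rewrite XE; exists j => //; exists y.
by have [[y0 _] _] := Yy; have [-> -> _] := st_sol_orbit j y0.
Qed.
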